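(* There are absolute constants $c>0$, $c_0>0$ and $d_0$ such that the following holds for all $d\ge d_0$. Let $\Sigma=(V,E)$ be a $d$-regular bipartite graph with $N=|V|\ge d^2$ vertices and bipartite expansion constant $\delta=\delta(\Sigma)$. If $\lambda>0$ and $\delta$ satisfy $$\beta(\lambda)\ \ge\ c\,\max\left\{\frac{\log(d^5/\delta)}{\sqrt d},\ \frac{\log^2 d}{\delta d}\right\},$$ then the mixing time of the Glauber dynamics chain $\mathcal M_\lambda(\Sigma)$ satisfies $$\tau_{\mathcal M_\lambda(\Sigma)}\ \ge\ 2^{\,c_0\,N\,\alpha(\lambda)\,\beta(\lambda)\,\delta}.$$
   Context: Here $\log=\log_2$. Graphs are finite and simple. $\Sigma=(V,E)$ is a $d$-regular bipartite graph with partition classes $\mathcal E$ and $\mathcal O$; $N=|V|$ and $M=|\mathcal E|=|\mathcal O|=N/2$. Closure and expansion: For $u\in V$, $N(u)$ is the set of neighbours of $u$, and $N(A)=\bigcup_{w\in A}N(w)$. For $A\subseteq\mathcal E$ or $A\subseteq\mathcal O$ put $[A]=\{x\in V: N(x)\subseteq N(A)\}$; $A$ is small if $|[A]|\le M/2$. The bipartite expansion constant is $$\delta(\Sigma)=\min\left\{\frac{|N(A)|-|[A]|}{|N(A)|}: A\ne\emptyset,\ A\subseteq\mathcal E\text{ small or }A\subseteq\mathcal O\text{ small}\right\}.$$ One has $0\le\delta<1$. (If $\delta=0$, the condition on $\beta(\lambda)$ is regarded as not satisfied.) The functions $\alpha,\beta$ (with $\beta$ depending also on $d,\delta$): $$\alpha(\lambda)=\frac{\log(1+\lambda)}{44\,(1+\log(1+\lambda))\,\log\!\left(2+\frac1{\log(1+\lambda)}\right)},\qquad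 \beta(\lambda)=\frac{\log^2(1+\lambda)}{\log(1+\lambda)+\log(d^5/\delta)}.$$ Glauber dynamics: $\mathcal I(\Sigma)$ is the set of independent sets of $\Sigma$. $\mathcal M_\lambda(\Sigma)$ is the Markov chain on $\mathcal I(\Sigma)$ with transition probabilities, for $I,J\in\mathcal I(\Sigma)$: $P_\lambda(I,J)=0$ if $|I\triangle J|>1$; $P_\lambda(I,J)=\frac1{|V|}\frac{\lambda}{1+\lambda}$ if $|I\triangle J|=1$ and $I\subseteq J$; $P_\lambda(I,J)=\frac1{|V|}\frac1{1+\lambda}$ if $|I\triangle J|=1$ and $J\subseteq I$; and $P_\lambda(I,I)=1-\sum_{J'\ne I}P_\lambda(I,J')$. Its stationary distribution is the hard-core measure $\pi_\lambda(\{I\})=\lambda^{|I|}/\sum_{J\in\mathcal I(\Sigma)}\lambda^{|J|}$. Mixing time: for an ergodic chain $\mathcal M$ on a finite state space $\Omega$ with stationary distribution $\pi$ and $t$-step distributions $P^t(\omega_0,\cdot)$, $$\tau_{\mathcal M}=\max_{\omega_0\in\Omega}\min\left\{t_0:\ \tfrac12\sum_{\omega\in\Omega}|P^t(\omega_0,\omega)-\pi(\omega)|\le \tfrac1e\ \ \forall t>t_0\right\}.$$ *)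

(* Defs.v *)
From HB Require Import structures.
From mathcomp Require Import all_boot all_order all_algebra.
From mathcomp Require Import classical_sets reals sequences exp.

Set Implicit Arguments.
Unset Strict Implicit.
Unset Printing Implicit Defensive.
Import Order.TTheory GRing.Theory Num.Theory.

Local Open Scope ring_scope.

Section Graphs.
Variables (V : finType) (e : rel V).
Implicit Types (u : V) (A : {set V}).

Definition simple_graph : Prop := symmetric e /\ irreflexive e.

Definition neighbours u : {set V} := finset (e u).

Definition regular (d : nat) : Prop := forall u, #|neighbours u| = d.

Definition bipartition (E O : {set V}) : Prop :=
  [/\ E :|: O = finset.setT, E :&: O = finset.set0 &
      forall x y, e x y ->
        (x \in E) && (y \in O) || (x \in O) && (y \in E)].

Definition nbhd A : {set V} := (\bigcup_(w in A) neighbours w)%SET.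

Definition nclosure A : {set V} := finset (fun x => neighbours x \subset nbhd A).

(* |[A]| <= M / 2, where M = |E| = |O|. *)
Definition small (E A : {set V}) : bool := (2 * #|nclosure A| <= #|E|)%N.

Definition expansion_ratio (R : realType) A : R :=
  (#|nbhd A|%:R - #|nclosure A|%:R) / #|nbhd A|%:R.

(* The unit 1 of the iterated minimum is never attained: in a d-regular graph
   with d > 0, a nonempty A has A \subset nclosure A and nbhd A nonempty, so
   each ratio is < 1.  The range is nonempty when d >= 4 and |V| >= d ^ 2, as
   singletons are then small. *)
Definition bip_expansion (R : realType) (E O : {set V}) : R :=
  \big[Num.min/1]_(A : {set V} | (A != finset.set0) &&
      (((A \subset E) || (A \subset O)) && small E A)) expansion_ratio R A.

Definition independent (I : {set V}) : bool :=
  [forall x in I, forall y in I, ~~ e x y].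

Definition indep_set : finType := {I : {set V} | independent I}.

Definition symdiff (I J : {set V}) : {set V} := (I :\: J) :|: (J :\: I).

Section Glauber.
Variables (R : realType) (lambda : R).

(* Transition probability between distinct states. *)
Definition glauber_move (I J : indep_set) : R :=
  if #|symdiff (val I) (val J)| == 1%N then
    if val I \subset val J then #|V|%:R^-1 * (lambda / (1 + lambda))
    else #|V|%:R^-1 * (1 / (1 + lambda))
  else 0.

Definition glauber (I J : indep_set) : R :=
  if I == J then 1 - \sum_(J' | J' != I) glauber_move I J'
  else glauber_move I J.

Definition hard_core (I : indep_set) : R :=
  lambda ^+ #|val I| / \sum_(J : indep_set) lambda ^+ #|val J|.

End Glauber.
End Graphs.

Section MixingTime.
Variables (R : realType) (T : finType) (P : T -> T -> R) (pi : T -> R).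

Fixpoint tstep (t : nat) (x y : T) : R :=
  if t is t'.+1 then \sum_z P x z * tstep t' z y else (x == y)%:R.

Definition tv_dist (mu nu : T -> R) : R :=
  2%:R^-1 * \sum_(x : T) `|mu x - nu x|.

Definition mixed_after (x : T) (t0 : nat) : Prop :=
  forall t, (t0 < t)%N -> tv_dist (tstep t x) pi <= (expR 1)^-1.

(* The least t0 with mixed_after x t0; it exists for an ergodic chain with
   stationary distribution pi, and the value is 0 when there is none. *)
Definition mixing_from (x : T) : nat :=
  xget 0%N (fun t0 => mixed_after x t0 /\
                      forall t1, mixed_after x t1 -> (t0 <= t1)%N).

Definition mixing_time : nat := (\max_(x : T) mixing_from x)%N.

End MixingTime.

Section Functions.
Variable R : realType.

Definition log2 (x : R) : R := ln x / ln 2%:R.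

Definition alpha (lambda : R) : R :=
  log2 (1 + lambda) /
  (44%:R * (1 + log2 (1 + lambda)) * log2 (2%:R + 1 / log2 (1 + lambda))).

Definition beta (d : nat) (delta lambda : R) : R :=
  log2 (1 + lambda) ^+ 2 /
  (log2 (1 + lambda) + log2 (d%:R ^+ 5 / delta)).

End Functions.

Arguments bip_expansion {V} e R E O.
Arguments glauber {V} e {R} lambda I J.
Arguments hard_core {V} e {R} lambda I.

(* Main.v *)
Require Import Defs.
From HB Require Import structures.
From mathcomp Require Import all_boot all_order all_algebra.
From mathcomp Require Import classical_sets reals sequences exp.
From mathcomp Require Import boolp fintype finset ring lra zify.

Set Implicit Arguments.
Unset Strict Implicit.
Unset Printing Implicit Defensive.
Import Order.TTheory GRing.Theory Num.Theory.

Local Open Scope ring_scope.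

(** Each transition of the chain changes the number of occupied vertices of [E] minus
that of [O] by at most one, so the balanced independent sets (as many vertices in
[E] as in [O]) separate those dominated by [E] from those dominated by [O].  Both
dominated classes have weight at least [(1 + lambda)^M - 1]; hence it suffices that
the balanced sets weigh [(1 + lambda)^M] times an exponentially small factor.

In a balanced set at least one side [A] is small; write [g = |N(A)|], [a = |cl A|].
The balanced sets with [|A| <= alpha M] weigh little.  Otherwise the other side avoids
[N(A)], which costs [(1 + lambda)^(-g)], and the sum of [lambda^|A|] over all [A] with
given [a] and [g] is bounded by containers.  One finds [F] inside [N(A)] and [S]
containing [cl A] with [|S| <= |F| + O((g - a) / sqrt d)] that are determined by
[O(g log d / d) + O((g - a) / sqrt d)] vertices.  Because [g >= alpha M], these
may be chosen among all vertices, and no connectivity of [A] is needed.  If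
[|F| <= g - gamma (g - a)], then [A] is a subset of the set [S], which is smaller than
[N(A)]; otherwise fewer than [gamma (g - a)] further vertices determine [N(A)], hence
[cl A].  For [gamma = log(1+lambda) / (2 (log(1+lambda) + log(d^5/delta)))] both cases
gain a factor [2^(- Omega(beta (g - a)))], and [g - a >= delta g]. *)

(** * Conductance and ergodicity of finite Markov chains *)

Lemma sum_setC (R : nmodType) (T : finType) (S : {set T}) (F : T -> R) :
  \sum_x F x = \sum_(x in S) F x + \sum_(x in ~: S) F x.
Proof.
rewrite (bigID (mem S)) /=; congr (_ + _).
by apply: eq_bigl => x; rewrite inE.
Qed.

Section FiniteMarkovChains.
Variables (R : realType) (T : finType) (P : T -> T -> R) (pi : T -> R).

Hypothesis P_ge0 : forall x y, 0 <= P x y.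
Hypothesis P_sum1 : forall x, \sum_y P x y = 1.
Hypothesis pi_ge0 : forall x, 0 <= pi x.
Hypothesis pi_sum1 : \sum_x pi x = 1.
Hypothesis pi_stationary : forall y, \sum_x pi x * P x y = pi y.

Lemma tstep_ge0 t x y : 0 <= tstep P t x y.
Proof.
elim: t x => [|t IH] x /=; first by rewrite ler0n.
by apply: sumr_ge0 => z _; rewrite mulr_ge0.
Qed.

Lemma tstep_sum1 t x : \sum_y tstep P t x y = 1.
Proof.
elim: t x => [|t IH] x /=.
  rewrite (bigD1 x) //= eqxx big1 ?addr0 // => y.
  by rewrite eq_sym => /negbTE ->.
rewrite exchange_big /=; under eq_bigr => z _ do rewrite -mulr_sumr IH mulr1.
exact: P_sum1.
Qed.

Lemma tstepD m n x y :
  tstep P (m + n) x y = \sum_z tstep P m x z * tstep P n z y.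
Proof.
elim: m x => [|m IH] x /=.
  rewrite (bigD1 x) //= eqxx mul1r big1 ?addr0 // => z.
  by rewrite eq_sym => /negbTE ->; rewrite mul0r.
under eq_bigr => z _ do rewrite IH mulr_sumr.
rewrite exchange_big /=; apply: eq_bigr => z _.
by rewrite mulr_suml; apply: eq_bigr => w _; rewrite mulrA.
Qed.

Lemma tstep_stationary t y : \sum_x pi x * tstep P t x y = pi y.
Proof.
elim: t y => [|t IH] y /=.
  rewrite (bigD1 y) //= eqxx mulr1 big1 ?addr0 // => z /negbTE ->.
  by rewrite mulr0.
under eq_bigr => x _ do rewrite mulr_sumr.
rewrite exchange_big /= -[RHS]IH; apply: eq_bigr => z _.
by under eq_bigr => x _ do rewrite mulrA; rewrite -mulr_suml pi_stationary.
Qed.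

(** * Escape from a set through a small flow *)

Section Bottleneck.
Variable S : {set T}.

(** Condition on the first step. If it stays in [S], stationarity bounds the mass arriving at [z] by
    [pi z], so the induction hypothesis applies; if it leaves, the rest has probability at most 1
    and one unit of flow is paid. *)
Lemma escape_le t :
  \sum_(x in S) pi x * (\sum_(y in ~: S) tstep P t x y)
    <= t%:R * \sum_(x in S) \sum_(y in ~: S) pi x * P x y.
Proof.
elim: t => [|t IH].
  rewrite mul0r big1 // => x xS; rewrite big1 ?mulr0 // => y /=.
  by rewrite inE; case: eqP => // <-; rewrite xS.
pose q z := \sum_(y in ~: S) tstep P t z y.
have q_ge0 z : 0 <= q z by apply: sumr_ge0 => y _; exact: tstep_ge0.
have q_le1 z : q z <= 1.
  rewrite -(tstep_sum1 t z) (sum_setC S (tstep P t z)) lerDr.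
  by apply: sumr_ge0 => y _; exact: tstep_ge0.
have -> : \sum_(x in S) pi x * (\sum_(y in ~: S) tstep P t.+1 x y)
    = \sum_z (\sum_(x in S) pi x * P x z) * q z.
  rewrite /=; under eq_bigr => x _ do rewrite exchange_big /= mulr_sumr.
  rewrite exchange_big /=; apply: eq_bigr => z _.
  rewrite mulr_suml; apply: eq_bigr => x _.
  by rewrite -mulr_sumr mulrA.
rewrite (sum_setC S) -natr1 mulrDl mul1r; apply: lerD.
  apply: le_trans IH; apply: ler_sum => z zS; apply: ler_wpM2r => //.
  rewrite -[leRHS]pi_stationary (sum_setC S (fun x => _ * _)) lerDl.
  by apply: sumr_ge0 => x _; rewrite mulr_ge0.
rewrite [leRHS]exchange_big /=.
apply: ler_sum => z _; rewrite ler_piMr //.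
by apply: sumr_ge0 => x _; rewrite mulr_ge0.
Qed.

Lemma tv_dist_ge_escape t x :
  \sum_(y in ~: S) pi y - \sum_(y in ~: S) tstep P t x y
    <= tv_dist (tstep P t x) pi.
Proof.
have e : \sum_(y in S) (tstep P t x y - pi y)
    = \sum_(y in ~: S) pi y - \sum_(y in ~: S) tstep P t x y.
  rewrite sumrB; have := tstep_sum1 t x; have := pi_sum1.
  rewrite (sum_setC S) (sum_setC S (tstep P t x)).
  by move=> *; lra.
have h1 : \sum_(y in S) (tstep P t x y - pi y)
    <= \sum_(y in S) `|tstep P t x y - pi y|.
  by apply: ler_sum => y _; exact: ler_norm.
have h2 : - \sum_(y in ~: S) (tstep P t x y - pi y)
    <= \sum_(y in ~: S) `|tstep P t x y - pi y|.
  by rewrite -sumrN; apply: ler_sum => y _; rewrite -normrN; exact: ler_norm.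
rewrite sumrB in h2.
by rewrite /tv_dist (sum_setC S); lra.
Qed.

(** By averaging: if every start in [S] were within [eps] of [pi] after [t] steps, each would have
    left [S] with probability at least [1/2 - eps], which contradicts [escape_le]. *)
Lemma bottleneck_tv (eps : R) t :
  \sum_(x in S) pi x <= 2^-1 ->
  t%:R * (\sum_(x in S) \sum_(y in ~: S) pi x * P x y)
    < (2^-1 - eps) * \sum_(x in S) pi x ->
  exists2 x, x \in S & eps < tv_dist (tstep P t x) pi.
Proof.
move=> S_half flow_lt.
have [/existsP[x /andP[xS xP]]|] :=
  boolP [exists x, (x \in S) && (eps < tv_dist (tstep P t x) pi)].
  by exists x.
rewrite negb_exists => /forallP noX; exfalso.
move: flow_lt; apply/negP; rewrite -leNgt.
apply: le_trans (escape_le t); rewrite mulr_sumr.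
apply: ler_sum => x xS; rewrite mulrC; apply: ler_wpM2l => //.
have := noX x; rewrite xS /= -leNgt => tv_le.
have := tv_dist_ge_escape t x.
by have := pi_sum1; rewrite (sum_setC S); lra.
Qed.
End Bottleneck.

(** Doeblin's argument: as [v] has total mass zero, subtracting [eta] from every entry of [Q] does
    not change the image of [v], and the remaining kernel is nonnegative with row sums
    [1 - eta * #|T|]. *)
Lemma l1_contraction (Q : T -> T -> R) (eta : R) (v : T -> R) :
  (forall x y, eta <= Q x y) -> (forall x, \sum_y Q x y = 1) ->
  \sum_x v x = 0 ->
  \sum_y `|\sum_x v x * Q x y| <= (1 - eta * #|T|%:R) * \sum_x `|v x|.
Proof.
move=> Q_ge Q_sum v0.
have sub y : \sum_x v x * Q x y = \sum_x v x * (Q x y - eta).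
  under [RHS]eq_bigr => x _ do rewrite mulrBr.
  by rewrite sumrB -mulr_suml v0 mul0r subr0.
apply: (@le_trans _ _ (\sum_y \sum_x `|v x| * (Q x y - eta))).
  apply: ler_sum => y _; rewrite sub; apply: le_trans (ler_norm_sum _ _ _) _.
  apply: ler_sum => x _; rewrite normrM [X in _ * X]ger0_norm //.
  by rewrite subr_ge0.
rewrite exchange_big /= mulr_sumr; apply: ler_sum => x _.
by rewrite -mulr_sumr sumrB Q_sum sumr_const mulrC mulr_natr.
Qed.

Lemma ergodic_mixed_after (eta : R) n x :
  0 < eta -> (forall x y, eta <= tstep P n x y) ->
  exists t0, mixed_after P pi x t0.
Proof.
move=> eta_gt0 P_ge; pose rho := 1 - eta * #|T|%:R.
pose dist t := \sum_y `|tstep P t x y - pi y|.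
have sum0 t : \sum_y (tstep P t x y - pi y) = 0.
  by rewrite sumrB tstep_sum1 pi_sum1 subrr.
have distD s t : \sum_y `|\sum_z (tstep P s x z - pi z) * tstep P t z y|
    = dist (s + t)%N.
  apply: eq_bigr => y _; rewrite tstepD; congr `| _ |.
  under eq_bigr => z _ do rewrite mulrBl.
  by rewrite sumrB tstep_stationary.
have dist_n s : dist (s + n)%N <= rho * dist s.
  by rewrite -distD; apply: l1_contraction => //; exact: tstep_sum1.
have dist_noninc s t : dist (s + t)%N <= dist s.
  rewrite -distD -[leRHS]mul1r.
  have := @l1_contraction (tstep P t) 0 (fun z => tstep P s x z - pi z).
  by rewrite mul0r subr0; apply=> // [? ?|?]; [exact: tstep_ge0|exact: tstep_sum1].
have dist0 : dist 0 <= 2.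
  have <- : \sum_y (tstep P 0 x y + pi y) = 2.
    by rewrite big_split (tstep_sum1 0 x) pi_sum1.
  apply: ler_sum => y _; apply: le_trans (ler_normB _ _) _.
  by rewrite !ger0_norm ?tstep_ge0.
have rho_ge0 : 0 <= rho.
  rewrite /rho subr_ge0 mulr_natr -sumr_const -(tstep_sum1 n x).
  exact: ler_sum.
have dist_kn k : dist (k * n)%N <= rho ^+ k * 2.
  elim: k => [|k IH]; first by rewrite mul0n expr0 mul1r.
  rewrite mulSn addnC; apply: le_trans (dist_n _) _.
  by rewrite exprS -mulrA ler_wpM2l.
have Tpos : 0 < #|T|%:R :> R by rewrite ltr0n; apply/card_gt0P; exists x.
(* As [1 - x <= expR (- x)], this many blocks of [n] steps bring [rho ^+ k] below [1/e]; the initial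
   distance 2 cancels the factor 1/2 of [tv_dist]. *)
have [k kP] : exists k : nat, (eta * #|T|%:R)^-1 <= k%:R.
  exists (Num.truncn (eta * #|T|%:R)^-1).+1.
  by apply/ltW; rewrite truncnS_gt.
have rhok : rho ^+ k <= (expR 1)^-1.
  have : rho <= expR (- (eta * #|T|%:R)) by exact: (expR_ge1Dx (- (eta * #|T|%:R))).
  move=> /(lerXn2r k _ _) h; apply: le_trans (h _ _) _; rewrite ?nnegrE ?expR_ge0 //.
  rewrite -expRM_natr -expRN ler_expR.
  by rewrite mulNr lerN2 -ler_pdivrMl ?mulr1 ?mulr_gt0.
exists (k * n)%N => t kn_lt; rewrite /tv_dist -/(dist t).
have -> : t = (k * n + (t - k * n))%N by rewrite subnKC // ltnW.
have := dist_noninc (k * n)%N (t - k * n)%N; have := dist_kn k; lra.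
Qed.

(** Ergodicity enters because [mixing_from] would be 0 if no time were mixed; a lower bound must
    first exclude that default. *)
Lemma mixing_time_gt_unmixed (eta : R) n t x :
  0 < eta -> (forall x y, eta <= tstep P n x y) ->
  (expR 1)^-1 < tv_dist (tstep P t x) pi -> (t <= mixing_time P pi)%N.
Proof.
move=> eta_gt0 P_ge tv_gt.
apply: (@leq_trans (mixing_from P pi x)); last exact: leq_bigmax.
have [t0 t0P] := ergodic_mixed_after x eta_gt0 P_ge.
pose good s := boolp.asbool (mixed_after P pi x s).
have ex_good : exists s, good s by exists t0; apply/boolp.asboolP.
have [m /boolp.asboolP mP m_min] := ex_minnP ex_good.
rewrite /mixing_from; case: classical_sets.xgetP => [s -> [sP _]|].
  by rewrite leqNgt; apply/negP => /sP; rewrite leNgt tv_gt.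
move=> /(_ m) []; split => // t1 t1P.
by apply: m_min; apply/boolp.asboolP.
Qed.

End FiniteMarkovChains.

(** Detailed balance is carried through the induction by splitting off the first step on one side
    and the last step on the other. *)
Lemma reversible_tstep (R : realType) (T : finType) (P : T -> T -> R)
    (pi : T -> R) t x y :
  (forall x y, pi x * P x y = pi y * P y x) ->
  pi x * tstep P t x y = pi y * tstep P t y x.
Proof.
move=> rev; elim: t x y => [|t IH] x y.
  by rewrite /= eq_sym; case: eqP => [->|_] //; rewrite !mulr0.
rewrite -[in RHS]addn1 tstepD /= !mulr_sumr; apply: eq_bigr => z _.
rewrite (bigD1 x) //= eqxx big1 ?addr0 ?mulr1 => [|w /negbTE ->].
  by rewrite mulrA rev mulrAC IH mulrA mulrAC.
by rewrite mulr0.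
Qed.

Lemma finite_lower_bound (R : realType) (T : finType) (f : T -> R) :
  (forall x, 0 < f x) -> exists2 eta, 0 < eta & forall x, eta <= f x.
Proof.
move=> f_gt0; exists (\big[Num.min/1]_x f x); last by move=> x; exact: bigmin_le_cond.
by apply: lt_bigmin.
Qed.

(** * Glauber dynamics *)

Section SymmetricDifference.
Variable V : finType.
Implicit Types I J : {set V}.

Lemma symdiffC I J : symdiff I J = symdiff J I.
Proof. by rewrite /symdiff setUC. Qed.

Lemma in_symdiff I J x : (x \in symdiff I J) = ((x \in I) != (x \in J)).
Proof. by rewrite !inE; do 2!case: (x \in _). Qed.

Lemma symdiff_inj I : injective (symdiff I).
Proof.
move=> J K /setP eJK; apply/setP => x; move: (eJK x); rewrite !in_symdiff.
by do 3!case: (x \in _).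
Qed.

Lemma card_symdiff1 I J : #|symdiff I J| = 1%N ->
  (I \subset J /\ ~~ (J \subset I) /\ #|J| = #|I|.+1) \/
  (J \subset I /\ ~~ (I \subset J) /\ #|I| = #|J|.+1).
Proof.
have -> : #|symdiff I J| = (#|I :\: J| + #|J :\: I|)%N.
  rewrite cardsU (_ : _ :&: _ = set0) ?cards0 ?subn0 //.
  by apply/setP => x; rewrite !inE; do 2!case: (x \in _).
rewrite -!setD_eq0 -!cards_eq0 -(cardsID J I) -(cardsID I J) (setIC J I).
by move: #|I :\: J| #|J :\: I| #|I :&: J| => [|[|?]] [|[|?]] m //= _;
   [left|right]; rewrite ?addn0 ?addn1.
Qed.
End SymmetricDifference.

Section GlauberDynamics.
Variables (R : realType) (V : finType) (e : rel V) (lambda : R).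
Hypothesis lambda_gt0 : 0 < lambda.
Implicit Types I J : indep_set e.

Let lambda1_gt0 : 0 < 1 + lambda. Proof. by rewrite addr_gt0. Qed.

Definition hc_weight (X : {set indep_set e}) : R :=
  \sum_(I in X) lambda ^+ #|val I|.

Definition partition_function : R := \sum_(I : indep_set e) lambda ^+ #|val I|.

Lemma independentS (A B : {set V}) :
  A \subset B -> independent e B -> independent e A.
Proof.
move=> /fintype.subsetP AB /forall_inP B_ind; apply/forall_inP => x /AB xB.
apply/forall_inP => y /AB yB; exact: (forall_inP (B_ind x xB)).
Qed.

Lemma independent0 : independent e set0.
Proof. by apply/forall_inP => x; rewrite inE. Qed.

Definition empty_indep : indep_set e := exist _ set0 independent0.

Lemma glauber_move_ge0 I J : 0 <= glauber_move lambda I J.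
Proof.
rewrite /glauber_move; case: ifP => // _.
by case: ifP => _; rewrite mulr_ge0 ?invr_ge0 ?ler0n ?divr_ge0 // ltW.
Qed.

Lemma glauber_move_gt0 I J :
  #|symdiff (val I) (val J)| = 1%N -> 0 < glauber_move lambda I J.
Proof.
move=> IJ1; rewrite /glauber_move IJ1 eqxx.
have V_gt0 : 0 < #|V|%:R :> R.
  rewrite ltr0n; apply: leq_trans (max_card (mem (symdiff (val I) (val J)))).
  by rewrite IJ1.
by case: ifP => _; rewrite mulr_gt0 ?invr_gt0 ?divr_gt0.
Qed.

Lemma card_glauber_moves I :
  (#|[set J : indep_set e | #|symdiff (val I) (val J)| == 1%N]| <= #|V|)%N.
Proof.
rewrite -[leqRHS]bin1 -card_draws.
rewrite -(@card_imset _ _ (fun J => symdiff (val I) (val J))); last first.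
  by move=> J K /symdiff_inj /val_inj.
by apply/subset_leq_card/fintype.subsetP => X /imsetP[J]; rewrite !inE => ? ->.
Qed.

(** There are at most [#|V|] moves, each of probability at most [mu / #|V|] with [mu < 1]. The
    positive holding probability lets the chain wait at the empty set. *)
Lemma glauber_diag_gt0 I : 0 < glauber e lambda I I.
Proof.
rewrite /glauber eqxx subr_gt0.
pose mu := Num.max lambda 1 / (1 + lambda).
have mu_lt1 : mu < 1.
  by rewrite ltr_pdivrMr // mul1r gt_max ltrDr ltrDl ltr01.
have mu_ge0 : 0 <= mu by rewrite divr_ge0 ?le_max ?ler01 ?orbT // ltW.
apply: le_lt_trans mu_lt1.
apply: (@le_trans _ _ (\sum_(J in [set J : indep_set e |
    #|symdiff (val I) (val J)| == 1%N]) #|V|%:R^-1 * mu)).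
  rewrite [leRHS]big_mkcond [leLHS]big_mkcond /=; apply: ler_sum => J _.
  rewrite inE /glauber_move; case: ifP => _; case: ifP => _ //; last first.
    by rewrite mulr_ge0 ?invr_ge0.
  case: ifP => _; rewrite ler_wpM2l ?invr_ge0 // ler_wpM2r ?invr_ge0 ?(ltW lambda1_gt0) //.
    by rewrite le_max lexx.
  by rewrite le_max lexx orbT.
rewrite sumr_const -(mulr_natl (_ * mu)) mulrA.
apply: (@le_trans _ _ (1 * mu)); last by rewrite mul1r.
apply: ler_wpM2r => //; have [V0|V0] := posnP #|V|.
  by rewrite V0 invr0 mulr0.
by rewrite ler_pdivrMr ?ltr0n // mul1r ler_nat card_glauber_moves.
Qed.

Lemma glauber_ge0 I J : 0 <= glauber e lambda I J.
Proof.
have [<-|IJ] := eqVneq I J; first exact/ltW/glauber_diag_gt0.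
by rewrite /glauber (negbTE IJ) glauber_move_ge0.
Qed.

Lemma glauber_sum1 I : \sum_J glauber e lambda I J = 1.
Proof.
rewrite (bigD1 I) //= {1}/glauber eqxx -[RHS](subrK (\sum_(J | J != I) glauber_move lambda I J)).
congr (_ + _); apply: eq_bigr => J; rewrite eq_sym => /negbTE IJ.
by rewrite /glauber IJ.
Qed.

Lemma partition_function_gt0 : 0 < partition_function.
Proof.
rewrite /partition_function (bigD1 empty_indep) //=.
by rewrite ltr_pwDl ?exprn_gt0 // sumr_ge0 // => J _; rewrite exprn_ge0 ?ltW.
Qed.

Lemma hard_core_gt0 I : 0 < hard_core e lambda I.
Proof. by rewrite divr_gt0 ?exprn_gt0 ?partition_function_gt0. Qed.

Lemma hard_core_sum1 : \sum_I hard_core e lambda I = 1.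
Proof. by rewrite -mulr_suml divff // gt_eqF // partition_function_gt0. Qed.

Lemma glauber_reversible I J :
  hard_core e lambda I * glauber e lambda I J
    = hard_core e lambda J * glauber e lambda J I.
Proof.
have [<-//|IJ] := eqVneq I J.
rewrite /glauber (negbTE IJ) eq_sym (negbTE IJ) /hard_core mulrAC [RHS]mulrAC.
congr (_ / _); rewrite /glauber_move (symdiffC (val J)).
case: eqP => [/card_symdiff1|_]; last by rewrite !mulr0.
case=> -[-> [/negbTE -> ->]]; rewrite exprS; ring.
Qed.

Lemma glauber_stationary J :
  \sum_I hard_core e lambda I * glauber e lambda I J = hard_core e lambda J.
Proof.
under eq_bigr => I _ do rewrite glauber_reversible.
by rewrite -mulr_sumr glauber_sum1 mulr1.
Qed.

Lemma tstep_to_empty_gt0 k I :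
  (#|val I| <= k)%N -> 0 < tstep (glauber e lambda) k I empty_indep.
Proof.
elim: k I => [|k IH] I.
  rewrite leqn0 cards_eq0 => /eqP I0.
  by have -> : I = empty_indep; [exact: val_inj | rewrite /= eqxx].
move=> Ik /=.
have [K [IK Kk]] : exists K, 0 < glauber e lambda I K /\ (#|val K| <= k)%N.
  have [I0|[v vI]] := set_0Vmem (val I).
    by exists I; rewrite I0 cards0; split=> //; exact: glauber_diag_gt0.
  have IvI : independent e (val I :\ v) by exact: independentS (subsetDl _ _) (valP I).
  pose K : indep_set e := exist _ (val I :\ v) IvI.
  exists K; split; last by move: Ik; rewrite (cardsD1 v) vI.
  rewrite /glauber; case: eqP => [IK|_].
    by move: vI; rewrite {1}IK /= !inE eqxx.
  apply: glauber_move_gt0; rewrite -(cards1 v) /=; congr #|pred_of_set _|.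
  apply/setP => x; rewrite in_symdiff !inE.
  by have [->|] := eqVneq x v; rewrite ?vI //= eqxx.
rewrite (bigD1 K) //= ltr_pwDl ?mulr_gt0 ?IH // sumr_ge0 // => J _.
by rewrite mulr_ge0 ?glauber_ge0 // tstep_ge0 //; exact: glauber_ge0.
Qed.

(** Every state can be emptied within [#|V|] steps; by reversibility the empty set reaches every
    state in as many. *)
Lemma glauber_ergodic :
  exists2 eta : R, 0 < eta &
    forall I J, eta <= tstep (glauber e lambda) (#|V| + #|V|) I J.
Proof.
have [|eta eta_gt0 etaP] := @finite_lower_bound R (indep_set e * indep_set e)%type
    (fun p => tstep (glauber e lambda) (#|V| + #|V|) p.1 p.2).
  move=> [I J] /=; rewrite tstepD.
  have h K : 0 < tstep (glauber e lambda) #|V| K empty_indep.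
    by apply: tstep_to_empty_gt0; exact: max_card.
  rewrite (bigD1 empty_indep) //= ltr_pwDl //.
    rewrite mulr_gt0 //.
    rewrite -(pmulr_rgt0 _ (hard_core_gt0 empty_indep)).
    rewrite (reversible_tstep _ _ _ glauber_reversible) mulr_gt0 //.
    exact: hard_core_gt0.
  by rewrite sumr_ge0 // => K _; rewrite mulr_ge0 // tstep_ge0 //; exact: glauber_ge0.
by exists eta => // I J; exact: (etaP (I, J)).
Qed.

(** By reversibility the flow out of [S] equals the flow into [S] from its complement, which can
    only start in [B]; hence it is at most the measure of [B]. *)
Lemma glauber_bottleneck (S B : {set indep_set e}) t :
  (forall I J, I \in S -> J \notin S -> J \notin B -> glauber e lambda J I = 0) ->
  hc_weight S <= hc_weight (~: S) ->
  20 * t%:R * hc_weight B < hc_weight S ->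
  (t <= mixing_time (glauber e lambda) (hard_core e lambda))%N.
Proof.
move=> SB S_le tB_lt; set pi := hard_core e lambda.
have piE (X : {set indep_set e}) : \sum_(I in X) pi I = hc_weight X / partition_function.
  by rewrite mulr_suml.
have Z_gt0 := partition_function_gt0.
have pi_ge0 I : 0 <= pi I by rewrite ltW ?hard_core_gt0.
have S_half : \sum_(I in S) pi I <= 2^-1.
  rewrite piE ler_pdivrMr // /partition_function (sum_setC S).
  by move: S_le; rewrite /hc_weight; lra.
(* This is the source of the factor 20: [e >= (1 + 1/2)^2 = 9/4], and [4/9 < 9/20]. *)
have e_ineq : (expR 1)^-1 < 2^-1 - 20^-1 :> R.
  have h : 9 / 4 <= expR 1 :> R.
    have <- : expR (2^-1 * 2%:R) = expR 1 :> R by congr expR; field.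
    rewrite expRM_natr; have := expR_ge1Dx (2^-1 : R).
    have -> : 1 + 2^-1 = 3 / 2 :> R by field.
    by move=> h; rewrite expr2; nra.
  have : (expR 1)^-1 <= (9 / 4)^-1 :> R by rewrite lef_pV2 ?posrE ?expR_gt0 //; lra.
  lra.
have [||x xS tv_gt] := @bottleneck_tv R _ (glauber e lambda) pi glauber_ge0
    glauber_sum1 pi_ge0 hard_core_sum1 glauber_stationary S (2^-1 - 20^-1) t.
- exact: S_half.
- have -> : 2^-1 - (2^-1 - 20^-1) = 20^-1 :> R by ring.
  apply: (@le_lt_trans _ _ (t%:R * \sum_(I in B) pi I)).
    apply: ler_wpM2l => //; rewrite exchange_big /=.
    apply: (@le_trans _ _ (\sum_(J in B) pi J * \sum_I glauber e lambda J I)); last first.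
      by rewrite [leLHS](eq_bigr pi) // => J _; rewrite glauber_sum1 mulr1.
    rewrite [leLHS]big_mkcond [leRHS]big_mkcond; apply: ler_sum => J _.
    rewrite inE; case: (boolP (J \in S)) => JS /=.
      case: ifP => // _; rewrite mulr_ge0 // sumr_ge0 // => K _; exact: glauber_ge0.
    case: (boolP (J \in B)) => JB.
      under eq_bigr => I _ do rewrite [_ * _]glauber_reversible.
      rewrite -mulr_sumr ler_wpM2l // (sum_setC S (glauber e lambda J)) lerDl.
      by apply: sumr_ge0 => *; exact: glauber_ge0.
    rewrite big1 // => I IS.
    by rewrite [_ * _]glauber_reversible SB ?mulr0.
  rewrite !piE !mulrA ltr_pM2r ?invr_gt0 //; lra.
have [eta eta_gt0 etaP] := glauber_ergodic.
apply: (mixing_time_gt_unmixed glauber_ge0 glauber_sum1 pi_ge0 hard_core_sum1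
  glauber_stationary eta_gt0 etaP (x := x)).
exact: lt_trans tv_gt.
Qed.

End GlauberDynamics.

(** * Containers in regular bipartite graphs *)

Section Containers.
Variables (V : finType) (e : rel V).
Hypothesis e_sym : symmetric e.
Implicit Types (A B C F G S T : {set V}) (r d : nat).
Local Notation N := (neighbours e).

Lemma in_neighbours_sym u v : (v \in N u) = (u \in N v).
Proof. by rewrite !inE e_sym. Qed.

Lemma nbhdP A v : reflect (exists2 u, u \in A & v \in N u) (v \in nbhd e A).
Proof. exact: bigcupP. Qed.

Lemma neighbours_sub_nbhd A u : u \in A -> N u \subset nbhd e A.
Proof. exact: bigcup_sup. Qed.

Lemma nbhdS A B : A \subset B -> nbhd e A \subset nbhd e B.
Proof.
move=> /fintype.subsetP AB; apply/fintype.subsetP => v /nbhdP[u uA vu].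
by apply/nbhdP; exists u => //; exact: AB.
Qed.

Lemma nbhdU A B : nbhd e (A :|: B) = nbhd e A :|: nbhd e B.
Proof. exact: bigcup_setU. Qed.

Lemma double_count A B :
  (\sum_(u in A) #|N u :&: B| = \sum_(v in B) #|N v :&: A|)%N.
Proof.
under eq_bigr => u _ do rewrite -sum1_card.
rewrite (exchange_big_dep (mem B)) /= => [|u v _ /setIP[]//].
under [RHS]eq_bigr => v _ do rewrite -sum1_card.
apply: eq_bigr => v vB; apply: eq_bigl => u.
by rewrite !inE vB andbT e_sym andbC.
Qed.

Lemma sum_le_const (T : finType) (D : {set T}) (f : T -> nat) r :
  (forall x, x \in D -> f x <= r)%N -> (\sum_(x in D) f x <= #|D| * r)%N.
Proof. by move=> fr; rewrite -sum_nat_const leq_sum. Qed.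

Lemma sum_ge_const (T : finType) (D : {set T}) (f : T -> nat) r :
  (forall x, x \in D -> r <= f x)%N -> (#|D| * r <= \sum_(x in D) f x)%N.
Proof. by move=> fr; rewrite -sum_nat_const leq_sum. Qed.

(** Take [T] maximal such that its members reach on average at least [r] vertices outside [F]. A
    vertex of [C] with more than [r] neighbours still missed could be added to [T]. *)
Lemma saturating_set C F r :
  exists T, [/\ T \subset C, (#|T| * r <= #|nbhd e T :\: F|)%N &
    forall u, u \in C -> (#|N u :\: (F :|: nbhd e T)| <= r)%N].
Proof.
pose P T := (T \subset C) && (#|T| * r <= #|nbhd e T :\: F|)%N.
have P0 : P set0 by rewrite /P sub0set cards0.
have [T /maxsetP[/andP[TC Tr] Tmax] _] := maxset_exists P0.
exists T; split=> // u uC; rewrite leqNgt; apply/negP => u_many.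
have uT : u \in T.
  suff <- : u |: T = T by rewrite setU11.
  apply: Tmax; last exact: subsetUr.
  have uNT : u \notin T.
    apply/negP => uT; move: u_many; rewrite (_ : N u :\: _ = set0) ?cards0 //.
    apply/eqP; rewrite setD_eq0.
    exact: fintype.subset_trans (neighbours_sub_nbhd uT) (subsetUr _ _).
  rewrite /P subUset sub1set uC TC /= cardsU1 uNT mulnDl mul1n.
  apply: leq_trans (leq_add (ltnW u_many) Tr) _.
  rewrite -cardsUI [X in (_ + X)%N](_ : _ = 0%N) ?addn0.
    apply: subset_leq_card; apply/fintype.subsetP => v.
    rewrite nbhdU [nbhd e [set u]]big_set1 !(in_setU, in_setD).
    by do 3!case: (v \in _).
  apply/eqP; rewrite cards_eq0; apply/eqP/setP => v.
  by rewrite !in_setI !in_setD in_setU in_set0; do 3!case: (v \in _).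
move: u_many; rewrite (_ : N u :\: _ = set0) ?cards0 //.
apply/eqP; rewrite setD_eq0.
exact: fintype.subset_trans (neighbours_sub_nbhd uT) (subsetUr _ _).
Qed.

(** Each uncovered vertex has at least [d / 2] neighbours in [C], so by averaging some vertex of [C]
    covers a fraction [d / (2 * g)] of what is left; this is repeated [m] times. *)
Lemma greedy_cover (R : realType) C (U : {set V}) d g m :
  C != set0 -> (#|C| <= g)%N -> (d <= 2 * g)%N ->
  (forall v, v \in U -> d <= 2 * #|N v :&: C|)%N ->
  exists T, [/\ T \subset C, (#|T| <= m)%N &
    #|U :\: nbhd e T|%:R <= #|U|%:R * (1 - d%:R / (2 * g%:R)) ^+ m :> R].
Proof.
move=> C0 Cg d2g Ud; elim: m => [|m [T [TC Tm TU]]].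
  exists set0; rewrite sub0set cards0; split=> //.
  by rewrite expr0 mulr1 ler_nat subset_leq_card // subsetDl.
set U' := U :\: nbhd e T.
have g_gt0 : (0 < g)%N by apply: leq_trans Cg; rewrite card_gt0.
have [u uC uP] : exists2 u, u \in C & (d * #|U'| <= 2 * g * #|N u :&: U'|)%N.
  have [/exists_inP[u uC uP]|] := boolP [exists u in C, (d * #|U'| <= 2 * g * #|N u :&: U'|)%N].
    by exists u.
  rewrite negb_exists_in => /forall_inP noU; exfalso.
  have noUlt u : u \in C -> (2 * g * #|N u :&: U'| < d * #|U'|)%N.
    by move=> /noU; rewrite -ltnNge.
  (* Writing the strict inequality with a predecessor keeps it strict after summation over the
     nonempty [C]. *)
  have {}noU u : u \in C -> (2 * g * #|N u :&: U'| <= (d * #|U'|).-1)%N.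
    by move=> /noUlt; case: (d * _)%N.
  have := sum_le_const noU; rewrite -big_distrr /= double_count => h1.
  have [v vC] := set0Pn _ C0.
  have : (#|U'| * d <= \sum_(v in U') 2 * #|N v :&: C|)%N.
    by apply: sum_ge_const => w; rewrite inE => /andP[_ /Ud].
  rewrite -big_distrr /=; set s := (\sum_(_ in _) _)%N in h1 *.
  rewrite (mulnC _ d); have := noU _ vC; move: h1 Cg g_gt0.
  have [v0|v0] := posnP (d * #|U'|)%N; first by have := noUlt _ vC; rewrite v0.
  move: v0; move: (d * #|U'|)%N #|C| => x c; nia.
exists (u |: T); split.
- by rewrite subUset sub1set uC.
- by rewrite cardsU1; case: (u \notin T); rewrite ?add0n ?add1n //; exact: leqW.
rewrite exprSr mulrA.
have -> : U :\: nbhd e (u |: T) = U' :\: N u.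
  apply/setP => v; rewrite nbhdU /U' !in_setD in_setU negb_or.
  by rewrite [nbhd e [set u]]big_set1 andbA.
apply: (@le_trans _ _ (#|U'|%:R * (1 - d%:R / (2 * g%:R)))); last first.
  rewrite ler_wpM2r // subr_ge0 ler_pdivrMr ?mul1r ?mulr_gt0 ?ltr0n //.
  by rewrite -natrM ler_nat.
rewrite mulrBr mulr1 lerBrDr -(cardsID (N u) U') natrD [leRHS]addrC lerD2l.
rewrite mulrA ler_pdivrMr ?mulr_gt0 ?ltr0n //.
move: uP; rewrite -(ler_nat R) !natrM -(cardsID (N u) U') natrD (setIC U').
by lra.
Qed.

Section RegularBipartite.
Variables (E O : {set V}) (d : nat).
Hypotheses (EO : bipartition e E O) (e_reg : regular e d) (d_gt0 : (0 < d)%N).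

Lemma neighbours_E u : u \in E -> N u \subset O.
Proof.
case: EO => _ EO0 eEO uE; apply/fintype.subsetP => v; rewrite inE => /eEO.
have : u \notin O.
  by apply/negP => uO; have /setP/(_ u) := EO0; rewrite in_setI uE uO in_set0.
by rewrite uE /= => /negbTE ->; rewrite orbF.
Qed.

Lemma bipartitionC : bipartition e O E.
Proof.
case: EO => EOT EO0 eEO; split; rewrite 1?setUC 1?setIC //.
by move=> x y /eEO; rewrite orbC.
Qed.

Lemma nbhd_sub A : A \subset E -> nbhd e A \subset O.
Proof.
move=> /fintype.subsetP AE; apply/fintype.subsetP => v /nbhdP[u /AE uE].
by apply: fintype.subsetP; exact: neighbours_E.
Qed.

Lemma sub_nclosure A : A \subset nclosure e A.
Proof.
by apply/fintype.subsetP => u uA; rewrite inE neighbours_sub_nbhd.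
Qed.

Lemma neighbours_neq0 u : exists v, v \in N u.
Proof. by apply/set0Pn; rewrite -card_gt0 e_reg. Qed.

Lemma nclosure_sub A : A \subset E -> nclosure e A \subset E.
Proof.
move=> AE; apply/fintype.subsetP => u; rewrite inE => uA.
have [v vu] := neighbours_neq0 u.
have vO := fintype.subsetP (nbhd_sub AE) v (fintype.subsetP uA v vu).
case: EO => _ EO0 eEO; move: vu; rewrite inE => /eEO; rewrite vO andbT.
case/orP => // /andP[_ vE].
by have /setP/(_ v) := EO0; rewrite in_setI vE vO in_set0.
Qed.

(* A certificate for [C = nclosure e A] and [G = nbhd e A] is a tuple (T, T0, T1, T2).
   [T] covers most vertices of [G] with at least [d / 2] neighbours in [C], and
   [T0] consists of the remaining ones; [T1] (in [C]) and [T2] (outside [G]) remove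
   the vertices at which the resulting approximations miss more than [r] edges. *)
Definition opening (q : {set V} * {set V} * {set V} * {set V}) : {set V} :=
  let: (T, T0, T1, T2) := q in nbhd e (T :|: T1) :|: T0.

Definition outer_approx r (q : {set V} * {set V} * {set V} * {set V}) : {set V} :=
  [set u in E | (#|N u :\: opening q| <= r)%N] :\: nbhd e q.2.

(** For a certificate, [T2] leaves every vertex of [O] outside [G] with at most [r] neighbours in
    the outer approximation, so the vertices added here must belong to [G]. *)
Definition inner_approx r (q : {set V} * {set V} * {set V} * {set V}) : {set V} :=
  opening q :|: [set v in O | (r < #|N v :&: outer_approx r q|)%N].

Section Closure.
Variable A : {set V}.
Hypothesis A_sub : A \subset E.
Let C := nclosure e A.
Let G := nbhd e A.

Lemma nbhd_nclosure : nbhd e C = G.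
Proof.
apply/eqP; rewrite finset.eqEsubset; apply/andP; split; last exact: nbhdS (sub_nclosure A).
apply/fintype.subsetP => v /nbhdP[u]; rewrite inE => /fintype.subsetP uG; exact: uG.
Qed.

Lemma sum_neighbours_nclosure : (\sum_(v in G) #|N v :&: C| = d * #|C|)%N.
Proof.
rewrite -double_count -[RHS]mulnC -sum_nat_const; apply: eq_bigr => u.
by rewrite inE -(e_reg u) => /setIidPl ->.
Qed.

(** Since every edge at [C] ends in [G], exactly [d * (#|G| - #|C|)] edges at [G] avoid [C]. All
    bounds in terms of [#|G| - #|C|] come from this count. *)
Lemma sum_neighbours_setD_nclosure :
  (\sum_(v in G) #|N v :\: C| + d * #|C| = d * #|G|)%N.
Proof.
rewrite -sum_neighbours_nclosure -big_split /= [RHS]mulnC -sum_nat_const.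
by apply: eq_bigr => v _; rewrite addnC cardsID e_reg.
Qed.

Lemma card_nclosure_le : (#|C| <= #|G|)%N.
Proof. by rewrite -(leq_pmul2l d_gt0) -sum_neighbours_setD_nclosure leq_addl. Qed.

Lemma container_certificate (R : realType) r m :
  A != set0 -> (2 * r <= d)%N ->
  exists T T0 T1 T2 : {set V},
  [/\ [/\ T \subset E, (#|T| <= m)%N, T0 \subset O &
          #|T0|%:R <= #|G|%:R * (1 - d%:R / (2 * #|G|%:R)) ^+ m :> R],
      [/\ T1 \subset E, (#|T1| * r <= 2 * (#|G| - #|C|))%N,
          T2 \subset O & (#|T2| * r <= 2 * (#|G| - #|C|))%N] &
      let S := outer_approx r (T, T0, T1, T2) in
      let F := inner_approx r (T, T0, T1, T2) in
      [/\ C \subset S, F \subset G &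
          ((d - r) * #|S| + r * #|C| <= (d - r) * #|F| + r * #|G|)%N]].
Proof.
move=> A0 r2d.
have CE := nclosure_sub A_sub; have GO := nbhd_sub A_sub.
have C0 : C != set0.
  by apply: contraNneq A0 => C0; rewrite -subset0 -C0 sub_nclosure.
have NC u : u \in C -> N u \subset G by rewrite inE.
have CG := card_nclosure_le.
pose U := [set v in G | (d <= 2 * #|N v :&: C|)%N].
have d2G : (d <= 2 * #|G|)%N.
  have [u uC] := set0Pn _ C0; have := subset_leq_card (NC u uC).
  by rewrite e_reg; lia.
have [T [TC Tm TU]] : exists T, [/\ T \subset C, (#|T| <= m)%N &
    #|U :\: nbhd e T|%:R <= #|U|%:R * (1 - d%:R / (2 * #|G|%:R)) ^+ m :> R].
  by apply: greedy_cover => // v; rewrite inE => /andP[].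
pose T0 := U :\: nbhd e T.
have T0G : T0 \subset G.
  by apply/fintype.subsetP => v; rewrite !inE => /andP[_ /andP[]].
have [T1 [T1C T1r T1P]] := saturating_set C (nbhd e T :|: T0) r.
pose F0 := nbhd e (T :|: T1) :|: T0.
have F0G : F0 \subset G.
  by rewrite subUset T0G andbT -nbhd_nclosure nbhdS // subUset TC T1C.
have F0E : F0 = nbhd e T :|: T0 :|: nbhd e T1 by rewrite /F0 nbhdU setUAC.
pose S0 := [set u in E | (#|N u :\: F0| <= r)%N].
(* With [~: S0] as the set already reached, only neighbours inside [S0] are counted. As [T2] avoids
   [G], deleting its neighbourhood from [S0] removes nothing from [C]. *)
have [T2 [T2O T2r T2P]] := saturating_set (O :\: G) (~: S0) r.
exists T, T0, T1, T2; split.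
- split=> //; [exact: fintype.subset_trans TC CE|exact: fintype.subset_trans T0G GO|].
  apply: le_trans TU _; rewrite ler_wpM2r //.
    rewrite exprn_ge0 // subr_ge0 ler_pdivrMr ?mul1r -?natrM ?ler_nat //.
    by rewrite ltr0n muln_gt0 /= (leq_trans _ CG) // card_gt0.
  by rewrite ler_nat subset_leq_card //; apply/fintype.subsetP => v; rewrite inE => /andP[].
- split; [exact: fintype.subset_trans T1C CE| |exact: fintype.subset_trans T2O (subsetDl _ _)|].
  (* What [T1] newly reaches lies in [G] outside [U], so each such vertex sends more than [d / 2]
     edges out of [C]; the edge count leaves at most [2 * (#|G| - #|C|)] of them. *)
  + apply: leq_trans T1r _.
    apply: (@leq_trans #|G :\: (nbhd e T :|: T0)|).
      by apply: subset_leq_card; rewrite setSD // -nbhd_nclosure nbhdS.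
    have : (d * #|G :\: (nbhd e T :|: T0)| <= d * (2 * (#|G| - #|C|)))%N.
      have := sum_neighbours_setD_nclosure => h.
      have h1 : (#|G :\: (nbhd e T :|: T0)| * d
          <= \sum_(v in G :\: (nbhd e T :|: T0)) 2 * #|N v :\: C|)%N.
        apply: sum_ge_const => v; rewrite in_setD in_setU in_setD [v \in U]inE.
        case: (v \in nbhd e T) => //=; rewrite andbC => /andP[-> /=].
        by rewrite -ltnNge; have := cardsID C (N v); rewrite e_reg; clear; lia.
      have h2 : (\sum_(v in G :\: (nbhd e T :|: T0)) #|N v :\: C|
          <= \sum_(v in G) #|N v :\: C|)%N.
        by rewrite [leqRHS](big_setID (nbhd e T :|: T0)) /= leq_addl.
      move: h1; rewrite -big_distrr /= mulnC => h1.
      rewrite mulnCA mulnBr -h addnK; apply: leq_trans h1 _; rewrite leq_mul2l h2.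
      exact: orbT.
    by rewrite leq_pmul2l.
  (* Likewise each vertex of [S0] outside [C] has at least [d - r >= d / 2] edges into [G]. *)
  + apply: leq_trans T2r _.
    apply: (@leq_trans #|S0 :\: C|).
      apply: subset_leq_card; apply/fintype.subsetP => u.
      rewrite in_setD in_setC negbK => /andP[uS0 /nbhdP[v vT2 uv]].
      have /setDP[_ vG] := fintype.subsetP T2O v vT2.
      rewrite in_setD uS0 andbT; apply/negP => /NC /fintype.subsetP.
      by move=> /(_ v); rewrite in_neighbours_sym uv => /(_ isT); rewrite (negbTE vG).
    have h := sum_neighbours_setD_nclosure.
    have h1 : (#|S0 :\: C| * (d - r) <= \sum_(u in ~: C) #|N u :&: G|)%N.
      apply: (@leq_trans (\sum_(u in S0 :\: C) #|N u :&: G|)).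
        apply: sum_ge_const => u; rewrite in_setD [u \in S0]inE => /and3P[_ _ ur].
        have := cardsID F0 (N u); rewrite e_reg.
        by move: ur (subset_leq_card (setIS (N u) F0G)); clear; lia.
      rewrite [leqRHS](big_setID S0) /=.
      by rewrite (_ : ~: C :&: S0 = S0 :\: C) ?leq_addr // setDE setIC.
    have h2 : (\sum_(u in ~: C) #|N u :&: G| = \sum_(v in G) #|N v :\: C|)%N.
      by rewrite double_count; apply: eq_bigr => v _; rewrite setDE.
    have : (d * #|S0 :\: C| <= d * (2 * (#|G| - #|C|)))%N.
      rewrite mulnCA mulnBr -h addnK -h2; apply: leq_trans (leq_mul (leqnn 2) h1).
      by rewrite mulnC mulnCA leq_mul //; move: r2d; clear; lia.
    by rewrite leq_pmul2l.
rewrite /inner_approx /outer_approx /= -/F0 -/S0; set S := S0 :\: nbhd e T2; set F := F0 :|: _.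
have CS : C \subset S.
  apply/fintype.subsetP => u uC; rewrite in_setD [u \in S0]inE.
  rewrite (fintype.subsetP CE) // F0E T1P // !andbT.
  apply/negP => /nbhdP[v vT2 uv].
  have /setDP[_ vG] := fintype.subsetP T2O v vT2.
  move/(_ v): (fintype.subsetP (NC u uC)); rewrite in_neighbours_sym uv => /(_ isT).
  by rewrite (negbTE vG).
have T2S v : v \in O :\: G -> (#|N v :&: S| <= r)%N.
  move=> /T2P; apply: leq_trans; apply/subset_leq_card/fintype.subsetP => u.
  by rewrite !(in_setI, in_setD, in_setU, in_setC) negb_or negbK => /and3P[-> -> ->].
have FG : F \subset G.
  rewrite subUset F0G; apply/fintype.subsetP => v; rewrite inE => /andP[vO vr].
  by apply: contraLR vr => vG; rewrite -leqNgt T2S // in_setD vG.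
split=> //.
(* The [d * #|S|] edges at [S] are split by their end: at most [d] per vertex of [F], at most [r]
   per vertex of [G :\: F], and at most [r] leaving [G] per vertex of [S :\: C]. *)
have sumS : (\sum_(u in S) #|N u| = #|S| * d)%N.
  by rewrite -sum_nat_const; apply: eq_bigr => u _; rewrite e_reg.
have splitS : (\sum_(u in S) #|N u| = \sum_(u in S) #|N u :&: F|
     + \sum_(u in S) #|N u :&: (G :\: F)| + \sum_(u in S) #|N u :\: G|)%N.
  rewrite -!big_split /=; apply: eq_bigr => u _.
  rewrite -(cardsID G (N u)); congr (_ + _)%N.
  rewrite -(cardsID F (N u :&: G)) -setIA (setIidPr FG); congr (_ + #|pred_of_set _|)%N.
  by rewrite setIDA.
have b1 : (\sum_(u in S) #|N u :&: F| <= #|F| * d)%N.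
  rewrite double_count; apply: sum_le_const => v _.
  by rewrite -(e_reg v) subset_leq_card // subsetIl.
have b2 : (\sum_(u in S) #|N u :&: (G :\: F)| <= #|G :\: F| * r)%N.
  rewrite double_count; apply: sum_le_const => v; rewrite in_setD => /andP[vF vG].
  by move: vF; rewrite in_setU negb_or inE (fintype.subsetP GO) // -leqNgt => /andP[].
have b3 : (\sum_(u in S) #|N u :\: G| <= #|S :\: C| * r)%N.
  rewrite (big_setID C) /= big1 ?add0n => [|u /setIP[_ /NC]]; last first.
    by rewrite -setD_eq0 => /eqP ->; rewrite cards0.
  apply: sum_le_const => u; rewrite in_setD [u \in S]in_setD [u \in S0]inE.
  case/and4P => _ _ _; apply: leq_trans.
  by apply: subset_leq_card; exact: setDS.
have := cardsID C S; rewrite (setIidPr CS); have := cardsID F G; rewrite (setIidPr FG).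
move: sumS splitS b1 b2 b3 r2d; clear; nia.
Qed.

End Closure.
End RegularBipartite.
End Containers.

(** * Counting small subsets and summing weights over containers *)

Section WeightedSubsets.
Variables (R : realType) (V : finType).
Implicit Types (U X A : {set V}) (lambda s y : R).

Lemma sum_subsets_expr U y : \sum_(X : {set V} | X \subset U) y ^+ #|X| = (1 + y) ^+ #|U|.
Proof.
pose F i : R := if i \in U then y else 0.
have -> : (1 + y) ^+ #|U| = \prod_i (F i + 1).
  rewrite -prodr_const (big_mkcond (mem U)) /=; apply: eq_bigr => i _.
  by rewrite /F; case: ifP => _; rewrite ?add0r // addrC.
rewrite bigA_distr big_mkcond /=; apply: eq_bigr => X _.
rewrite -big_mkcond /=; case: ifP => [/fintype.subsetP XU|/negbT /subsetPn[i iX iU]].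
  by rewrite -prodr_const; apply: eq_bigr => i /XU; rewrite /F => ->.
by rewrite (bigD1 i) //= /F (negbTE iU) mul0r.
Qed.

Definition small_subsets U (m : R) : {set {set V}} :=
  [set X : {set V} | (X \subset U) && (#|X|%:R <= m)].

(* Chernoff's bound: a small set [X] has [1 <= expR (s * (m - #|X|))]. *)
Lemma card_small_subsets U m s : 0 <= s ->
  #|small_subsets U m|%:R <= expR (m * s + expR (- s) * #|U|%:R).
Proof.
move=> s_ge0.
apply: (@le_trans _ _ (\sum_(X : {set V} | X \subset U) expR (m * s) * expR (- s) ^+ #|X|)).
  rewrite -sum1_card natr_sum [leLHS]big_mkcond [leRHS]big_mkcond /=.
  apply: ler_sum => X _; rewrite inE; case: (X \subset U) => //=.
  have pos : 0 <= expR (m * s) * expR (- s) ^+ #|X|.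
    by rewrite mulr_ge0 ?exprn_ge0 ?expR_ge0.
  case: ifP => // Xm; rewrite -expRM_natr -expRD -[leLHS]expR0 ler_expR.
  by nra.
rewrite -mulr_sumr sum_subsets_expr expRD expRM_natr ler_wpM2l ?expR_ge0 //.
by rewrite lerXn2r ?nnegrE ?addr_ge0 ?expR_ge0 ?expR_ge1Dx.
Qed.

Lemma container_sum (I : finType) (D : {set I}) (W : I -> {set V})
    (Fam : {set {set V}}) lambda (h : R) :
  0 <= lambda -> 0 <= h ->
  (forall A, A \in Fam ->
     exists2 i, i \in D & A \subset W i /\ (1 + lambda) ^+ #|W i| <= h) ->
  \sum_(A in Fam) lambda ^+ #|A| <= #|D|%:R * h.
Proof.
(* [D] may contain indices with heavy [W i]; discarding them by [ok] lets a union bound over all of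
   [D] be used. *)
move=> l_ge0 h_ge0 cov; pose ok i := (1 + lambda) ^+ #|W i| <= h.
apply: (@le_trans _ _ (\sum_(A in Fam) \sum_(i in D | ok i && (A \subset W i)) lambda ^+ #|A|)).
  apply: ler_sum => A /cov[i iD [AW Wh]].
  rewrite (bigD1 i) /=; last by rewrite iD AW /ok Wh.
  by rewrite lerDl sumr_ge0 // => j _; rewrite exprn_ge0.
rewrite (exchange_big_dep (mem D)) /= => [|A i _ /andP[]//].
rewrite mulr_natl -sumr_const; apply: ler_sum => i iD; rewrite iD.
have [Wh|Wh] := boolP (ok i); last by rewrite big1 // => A; rewrite andbF.
apply: le_trans Wh; rewrite -sum_subsets_expr /=.
rewrite [leLHS]big_mkcond [leRHS]big_mkcond /=; apply: ler_sum => A _.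
case: (A \in Fam) => //=; case: ifP => // _.
by rewrite exprn_ge0.
Qed.
End WeightedSubsets.

Lemma expR1_le4 (R : realType) : expR 1 <= 4 :> R.
Proof.
have := expR_ge1Dx (- 2^-1 : R); rewrite expRN.
have -> : 1 - 2^-1 = 2^-1 :> R by field.
rewrite lef_pV2 ?posrE ?expR_gt0 // => h.
have -> : expR 1 = expR 2^-1 ^+ 2 :> R by rewrite -expRM_natr; congr expR; field.
have -> : 4 = 2 ^+ 2 :> R by rewrite -natrX.
by rewrite lerXn2r ?nnegrE ?expR_ge0.
Qed.

(** * Weight of the sets with prescribed sizes of closure and neighbourhood *)

Section ClosureClasses.
Variables (R : realType) (V : finType) (e : rel V) (E O : {set V}) (d : nat).
Hypotheses (e_sym : symmetric e) (EO : bipartition e E O) (e_reg : regular e d).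
Hypotheses (d_large : (256 <= d)%N) (card_EO : #|O| = #|E|).
(* With natural logarithms, [b] is [ln 2 * beta] and [ell / (2 * (ell + kappa))]
   is the threshold [gamma] between the two kinds of containers. *)
Variables (ell kappa delta lambda b L sD : R).
Local Notation D := (d%:R : R).
Hypotheses (ell_gt0 : 0 < ell) (kappa_gt0 : 0 < kappa).
Hypotheses (delta_gt0 : 0 < delta) (delta_le1 : delta <= 1).
Hypothesis lambdaE : 1 + lambda = expR ell.
Hypothesis kappaE : expR kappa = D ^+ 5 / delta.
Hypothesis LE : expR L = D.
Hypotheses (sD_gt0 : 0 < sD) (sDD : sD * sD = D).
Hypothesis bE : b * (ell + kappa) = ell ^+ 2.
Hypothesis b_kappa : 2 ^+ 14 * kappa <= b * sD.
Hypothesis b_delta : 2 ^+ 14 * L ^+ 2 <= b * delta * D.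

Definition closure_class (a g : nat) : {set {set V}} :=
  [set A : {set V} | [&& A \subset E, A != set0, #|nclosure e A| == a
                                              & #|nbhd e A| == g]].

Let D_ge : 256 <= D. Proof. by rewrite ler_nat. Qed.
Let D_gt0 : 0 < D. Proof. by apply: lt_le_trans D_ge. Qed.
Let sD_ge : 16 <= sD.
Proof.
rewrite -(ler_pXn2r (n := 2)) ?nnegrE ?(ltW sD_gt0) // [leRHS]expr2 sDD.
by apply: le_trans D_ge; rewrite -natrX ler_nat.
Qed.
Let L_ge1 : 1 <= L.
Proof. by rewrite -ler_expR LE; apply: le_trans D_ge; have := expR1_le4 R; lra. Qed.
Let lk_gt0 : 0 < ell + kappa. Proof. exact: addr_gt0. Qed.
Let b_gt0 : 0 < b. Proof. by rewrite -(pmulr_lgt0 _ lk_gt0) bE exprn_gt0. Qed.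
Let b_le : b <= ell.
Proof. by rewrite -(ler_pM2r lk_gt0) bE expr2 ler_pM2l // lerDl ltW. Qed.

Section Bounds.
Variables (g t M : R).
Hypotheses (t_ge : delta * g <= t) (M_le : M <= 176 * sD * g) (D_le : D <= 352 * g).

Let g_gt0 : 0 < g. Proof. by move: D_le D_ge; lra. Qed.
Let t_ge0 : 0 <= t. Proof. by apply: le_trans t_ge; rewrite mulr_ge0 // ltW. Qed.

(** The left side bounds the logarithm of the number of certificates and one term of the gap sets.
    Chernoff's parameter is [2 * L] for [T] and [T0], and [kappa] for [T1], [T2] and the gap; then
    [expR (- (2 * L)) = D^-2] and [expR (- kappa) <= D^-2] make the terms in [M] of order
    [g / D]. *)
Lemma entropy_bound :
  (2 * g * L / D + 1) * (2 * L) + (g / D) * (2 * L)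
   + 2 * (expR (- (2 * L)) * M)
   + 2 * (4 * t / sD * kappa) + 3 * (expR (- kappa) * M) <= b * t / 10.
Proof.
pose x := g / D; have gE : g = x * D by rewrite divfK // gt_eqF.
have x_gt0 : 0 < x by rewrite divr_gt0.
pose y := x * L ^+ 2.
have y_bt : 2 ^+ 14 * y <= b * t.
  have h : 2 ^+ 14 * L ^+ 2 * x <= b * delta * D * x by rewrite ler_pM2r.
  have : b * (delta * g) <= b * t by rewrite ler_pM2l.
  rewrite gE /y; move: h; lra.
have k_bt : 2 ^+ 14 * (t / sD * kappa) <= b * t.
  have -> : 2 ^+ 14 * (t / sD * kappa) = 2 ^+ 14 * kappa * t / sD by ring.
  rewrite ler_pdivrMr //.
  have := ler_wpM2r t_ge0 b_kappa; lra.
have y_x : x <= y by rewrite ler_peMr ?(ltW x_gt0) // expr_ge1 //; move: L_ge1; lra.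
have y_xL : x * L <= y.
  by rewrite /y expr2 mulrA ler_peMr // mulr_ge0 ?(ltW x_gt0) //; move: L_ge1; lra.
have e1 : expR (- (2 * L)) = (D * D)^-1.
  by rewrite expRN mulrC expRM_natr LE.
have M_D : (D * D)^-1 * M <= 176 * x.
  rewrite ler_pdivrMl ?mulr_gt0 //; apply: le_trans M_le _.
  rewrite gE; have : sD <= D by rewrite -sDD ler_peMr ?(ltW sD_gt0) //; move: sD_ge; lra.
  move=> h; have := ler_wpM2r (ltW (mulr_gt0 x_gt0 D_gt0)) h; lra.
have e2 : expR (- kappa) * M <= 176 * x.
  rewrite expRN kappaE invf_div.
  have [M_neg|M_pos] := ltrP M 0.
    apply: (@le_trans _ _ 0); last by move: x_gt0; lra.
    by rewrite mulr_ge0_le0 ?divr_ge0 ?exprn_ge0 // ltW.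
  apply: le_trans M_D; apply: ler_wpM2r => //.
  rewrite ler_pdivrMr ?exprn_gt0 //; apply: le_trans delta_le1 _.
  have e3 (z : R) : 0 < z -> (z * z)^-1 * z ^+ 5 = z ^+ 3.
    by move=> z_gt0; field; rewrite gt_eqF.
  by rewrite e3 // expr_ge1 //; move: D_ge; lra.
(* This absorbs the additive [2 * L] caused by rounding up the number of greedy steps. *)
have one_x : 1 <= 352 * x by rewrite -(ler_pM2r D_gt0); move: D_le; rewrite gE; lra.
have L2 : 2 * L <= 704 * y by have := ler_wpM2r (le_trans ler01 L_ge1) one_x; move: y_xL; lra.
rewrite e1 -/x (_ : 2 * g * L / D = 2 * (x * L)); last by rewrite /x; ring.
have -> : (2 * (x * L) + 1) * (2 * L) = 4 * y + 2 * L by rewrite /y; ring.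
rewrite (_ : 4 * t / sD * kappa = 4 * (t / sD * kappa)); last by ring.
move: M_D e2 L2 y_bt k_bt y_x y_xL; lra.
Qed.

(** The gap between [f] and [g] gains [b * t / 2], by the choice of the threshold. The excess
    [s - f <= 2 * t / sD] costs at most half of that, because [8 * ell <= b * sD]. *)
Lemma outer_approx_weight (s f r : R) :
  (D - r) * (s - f) <= r * t -> 0 <= r -> r <= sD ->
  f <= g - ell / (2 * (ell + kappa)) * t ->
  ell * s <= ell * g - b * t / 4.
Proof.
move=> sf r_ge0 r_le f_le.
have sf' : sD * (s - f) <= 2 * t.
  have [sf_neg|sf_pos] := lerP (s - f) 0.
    by apply: (@le_trans _ _ 0); [rewrite mulr_ge0_le0 // ltW | rewrite mulr_ge0].
  have h1 : D / 2 * (s - f) <= (D - r) * (s - f).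
    by rewrite ler_pM2r //; move: sDD sD_ge r_le; nra.
  have h2 : r * t <= sD * t by rewrite ler_wpM2r.
  rewrite -(ler_pM2l sD_gt0) mulrA sDD; lra.
have l_b : 8 * ell <= b * sD.
  have h1 := ler_wpM2r (ltW sD_gt0) b_le.
  have h3 : 16 * ell <= ell * sD by rewrite mulrC ler_pM2l.
  rewrite -(ler_pM2r lk_gt0) [leRHS]mulrAC bE expr2.
  have -> : 8 * ell * (ell + kappa) = ell * (8 * (ell + kappa)) by ring.
  rewrite -mulrA ler_pM2l //.
  have k0 := kappa_gt0; have k1 := b_kappa; lra.
have l_g : ell * (ell / (2 * (ell + kappa)) * t) = b * t / 2.
  have -> : b = ell ^+ 2 / (ell + kappa) by rewrite -bE mulfK // gt_eqF.
  by field; rewrite gt_eqF.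
have h : ell * (s - f) <= b * t / 4.
  rewrite -(ler_pM2l sD_gt0).
  have h1 : ell * (sD * (s - f)) <= ell * (2 * t) by rewrite ler_pM2l.
  have h2 := ler_wpM2r t_ge0 l_b.
  lra.
have h' : ell * f <= ell * (g - ell / (2 * (ell + kappa)) * t) by rewrite ler_pM2l.
rewrite mulrBr l_g in h'; lra.
Qed.

(** Choosing the gap set costs at most half of the gain [ell * t] made by replacing [g] with [a]. *)
Lemma gamma_kappa : ell / (2 * (ell + kappa)) * t * kappa <= ell * t / 2.
Proof.
have : kappa / (ell + kappa) <= 1 by rewrite ler_pdivrMr // mul1r lerDr ltW.
rewrite (_ : ell / _ * _ * _ = ell * t / 2 * (kappa / (ell + kappa))); last first.
  by field; rewrite gt_eqF.
by move=> h; rewrite -[leRHS]mulr1 ler_wpM2l // divr_ge0 // mulr_ge0 // ltW.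
Qed.

End Bounds.

(** The taking of [r] near [sqrt d] balances the sizes of [T1] and [T2] against the excess of the
    outer over the inner approximation. The two alternatives are whether the inner approximation
    falls short of [g] by the threshold or not. *)
Lemma closure_class_container (a g : nat) :
  let t : R := g%:R - a%:R in
  let r := Num.truncn sD in
  delta * g%:R <= t -> D <= 352 * g%:R ->
  let certs := setX (setX (setX (small_subsets E (2 * g%:R * L / D + 1))
    (small_subsets O (g%:R / D))) (small_subsets E (4 * t / sD)))
    (small_subsets O (4 * t / sD)) in
  let gaps := small_subsets O (ell / (2 * (ell + kappa)) * t) in
  forall A, A \in closure_class a g ->
    (exists2 q, q \in certs & A \subset outer_approx e E r q /\
        (1 + lambda) ^+ #|outer_approx e E r q|
          <= expR (ell * g%:R - b * t / 4)) \/
    (exists2 q, q \in setX certs gaps &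
        let W := [set u | neighbours e u \subset inner_approx e E O r q.1 :|: q.2] in
        A \subset W /\ (1 + lambda) ^+ #|W| <= expR (ell * a%:R)).
Proof.
move=> t r t_ge D_le certs gaps A; rewrite inE => /and4P[A_sub A0 /eqP aE /eqP gE].
have g_gt0 : 0 < g%:R :> R by move: D_le (D_ge); lra.
have r_itv : r%:R <= sD < r.+1%:R by apply: truncn_itv; exact: ltW.
have r16 : (16 <= r)%N.
  by case/andP: r_itv => _; rewrite -ltnS -(ltr_nat R); apply: le_lt_trans.
have rD : (r * r <= d)%N.
  rewrite -(ler_nat R) natrM -sDD.
  by case/andP: r_itv => h _; rewrite ler_pM.
have sD_le : sD <= 2 * r%:R.
  apply: (@le_trans _ _ r.+1%:R); first by case/andP: r_itv => _ /ltW.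
  by rewrite -natrM ler_nat; move: r16; clear; lia.
have r2d : (2 * r <= d)%N by move: rD r16; clear; nia.
have d_gt0 : (0 < d)%N by move: r2d r16; clear; lia.
(* After this many greedy steps [(1 - d / (2 * g)) ^+ m <= expR (- L) = 1 / D], so at most [g / D]
   vertices remain for [T0]. *)
pose m := (Num.truncn (2 * g%:R * L / D)).+1.
have m_itv : 2 * g%:R * L / D <= m%:R <= 2 * g%:R * L / D + 1.
  have h0 : 0 <= 2 * g%:R * L / D.
    by rewrite divr_ge0 // !mulr_ge0 // (le_trans ler01 L_ge1).
  have /andP[h1 h2] := truncn_itv h0.
  by rewrite (ltW h2) /m -natr1 lerD2r h1.
have dg : (d <= g)%N.
  have [u uA] := set0Pn _ A0.
  by rewrite -gE -(e_reg u) subset_leq_card // neighbours_sub_nbhd.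
have [T [T0 [T1 [T2 []]]]] :=
  container_certificate e_sym EO e_reg d_gt0 A_sub R m A0 r2d.
rewrite aE gE => -[TE Tm T0O T0m] [T1E T1m T2O T2m].
set q := (T, T0, T1, T2); set S := outer_approx _ _ _ _; set F := inner_approx _ _ _ _ _.
move=> [CS FG SF].
have ag : (a <= g)%N.
  rewrite -(ler_nat R) -subr_ge0; apply: le_trans t_ge.
  by rewrite mulr_ge0 // ltW.
have card_le X : (#|X| * r <= 2 * (g - a))%N -> #|X|%:R <= 4 * t / sD.
  rewrite -(ler_nat R) !natrM natrB // -/t => h.
  rewrite ler_pdivlMr //.
  have : #|X|%:R * sD <= #|X|%:R * (2 * r%:R) by rewrite ler_wpM2l.
  move: h; lra.
have q_cert : q \in certs.
  rewrite !in_setX /= !inE TE T0O T1E T2O !card_le //= !andbT; apply/andP; split.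
    by apply: le_trans (proj2 (andP m_itv)); rewrite ler_nat.
  apply: le_trans T0m _; rewrite ler_pM2l //.
  apply: (@le_trans _ _ (expR (- (D / (2 * g%:R))) ^+ m)).
    rewrite lerXn2r ?nnegrE ?expR_ge0 ?expR_ge1Dx //.
    rewrite subr_ge0 ler_pdivrMr ?mulr_gt0 // mul1r.
    by rewrite -natrM ler_nat (leq_trans dg) // leq_pmull.
  rewrite -expRM_natr -LE -expRN ler_expR mulNr lerN2.
  rewrite mulrC mulrA ler_pdivlMr ?mulr_gt0 //.
  by case/andP: m_itv => h _; move: h; rewrite ler_pdivrMr // LE; lra.
have [f_le|f_gt] := lerP #|F|%:R (g%:R - ell / (2 * (ell + kappa)) * t).
  left; exists q => //; split; first exact: fintype.subset_trans (sub_nclosure e A) CS.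
  rewrite lambdaE -expRM_natr ler_expR.
  apply: (outer_approx_weight t_ge D_le (r := r%:R) _ _ _ f_le) => //; last by case/andP: r_itv.
  move: SF; rewrite -(ler_nat R) !natrD !natrM natrB ?(leq_trans _ r2d) ?leq_pmull //.
  by rewrite /t; lra.
right; exists (q, nbhd e A :\: F).
  rewrite in_setX q_cert inE /=; apply/andP; split.
    exact: fintype.subset_trans (subsetDl _ _) (nbhd_sub EO A_sub).
  have := cardsID F (nbhd e A); rewrite (setIidPr FG) gE -/F => /(congr1 (fun n => n%:R : R)).
  rewrite natrD => FGg. lra.
(* Adding the gap to the inner approximation gives back all of [nbhd e A], so [W] unfolds to the
   closure. *)
move=> W; have {W}-> : W = nclosure e A.
  rewrite /W /nclosure; congr (finset _); apply/boolp.funext => u /=; congr (_ \subset _).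
  by rewrite -/F -[X in X :|: _](setIidPr FG) setID.
rewrite aE sub_nclosure; split=> //.
by rewrite lambdaE -expRM_natr.
Qed.

(** The factor 2 counts the two kinds of containers. The first gains [b * t / 4], the second at
    least [ell * t / 2 >= b * t / 2] after paying for the gap; the remaining entropy is at most
    [b * t / 10]. *)
Lemma closure_class_weight (a g : nat) :
  delta * g%:R <= g%:R - a%:R -> #|E|%:R <= 176 * sD * g%:R -> D <= 352 * g%:R ->
  \sum_(A in closure_class a g) lambda ^+ #|A|
    <= 2 * expR (ell * g%:R - b * (g%:R - a%:R) / 8).
Proof.
set t : R := g%:R - a%:R; move=> t_ge M_le D_le.
have lambda_ge0 : 0 <= lambda by have := expR_ge1Dx ell; have := ell_gt0; rewrite -lambdaE; lra.
have := closure_class_container t_ge D_le; set r := Num.truncn _.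
set m1 := 2 * g%:R * L / D + 1; set m2 := 4 * t / sD.
set gm := ell / (2 * (ell + kappa)) * t; set certs := setX _ _; set gaps := small_subsets O gm.
set h1 := expR _; set h2 := expR _ => covered.
set x1 := expR (- (2 * L)) * #|E|%:R; set x2 := expR (- kappa) * #|E|%:R.
have L2_ge0 : 0 <= 2 * L by have := L_ge1; lra.
have kappa_ge0 := ltW kappa_gt0.
have cert_le : #|certs|%:R <= expR (m1 * (2 * L) + x1 + (g%:R / D * (2 * L) + x1)
    + (m2 * kappa + x2) + (m2 * kappa + x2)).
  rewrite (expRD (_ + _ + _)) (expRD (_ + _ + (_ + _))) (expRD (_ + x1)) !cardsX !natrM.
  have cle (U : {set V}) m s : #|U| = #|E| -> 0 <= s ->
      #|small_subsets U m|%:R <= expR (m * s + expR (- s) * #|E|%:R).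
    by move=> <- s_ge0; exact: card_small_subsets.
  by do 3![apply: ler_pM; rewrite ?mulr_ge0 //; last exact: cle]; exact: cle.
have gaps_le : #|gaps|%:R <= expR (gm * kappa + x2).
  by apply: le_trans (card_small_subsets _ _ kappa_ge0) _; rewrite card_EO.
have entropy := entropy_bound t_ge M_le D_le; have gk := gamma_kappa t_ge D_le.
have x2_ge0 : 0 <= x2 by rewrite mulr_ge0 ?expR_ge0.
have bt_ge0 : 0 <= b * t.
  rewrite mulr_ge0 ?(ltW b_gt0) //; apply: le_trans t_ge.
  by rewrite mulr_ge0 // ltW.
rewrite mulr_natl mulr2n.
pose good := [set A : {set V} | [exists q in certs, (A \subset outer_approx e E r q)
    && ((1 + lambda) ^+ #|outer_approx e E r q| <= h1)]].
rewrite (big_setID good) /=; apply: lerD.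
  apply: (@le_trans _ _ (#|certs|%:R * h1)).
    apply: (container_sum (W := outer_approx e E r)); rewrite ?expR_ge0 // => A.
    by case/setIP => _; rewrite in_set => /exists_inP[q qc /andP[]]; exists q.
  apply: le_trans (ler_wpM2r (expR_ge0 _) cert_le) _.
  rewrite -expRD ler_expR; move: entropy x2_ge0 bt_ge0; rewrite -/x1 -/x2 -/m1 -/m2 => h3 h4 h5.
  by rewrite -/t; lra.
apply: (@le_trans _ _ (#|setX certs gaps|%:R * h2)).
  apply: (container_sum (W := fun q => [set u | neighbours e u \subset
      inner_approx e E O r q.1 :|: q.2])); rewrite ?expR_ge0 // => A.
  case/setDP => /covered[[q qc [q1 q2]]|[q qc qW]]; last by exists q.
  by rewrite in_set => /exists_inP[]; exists q => //; rewrite q1 q2.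
rewrite cardsX natrM.
apply: (@le_trans _ _ (expR (m1 * (2 * L) + x1 + (g%:R / D * (2 * L) + x1)
    + (m2 * kappa + x2) + (m2 * kappa + x2)) * expR (gm * kappa + x2) * h2)).
  by rewrite ler_wpM2r ?expR_ge0 // ler_pM.
rewrite -!expRD ler_expR; move: entropy gk; rewrite -/x1 -/x2 -/m1 -/m2 -/gm => h3 h4.
have h5 : ell * a%:R = ell * g%:R - ell * t by rewrite /t; ring.
have h6 : b * t <= ell * t.
  rewrite ler_wpM2r // ; apply: le_trans t_ge.
  by rewrite mulr_ge0 // ltW.
by rewrite h5 -/t; lra.
Qed.

End ClosureClasses.

(** * The weight of the balanced independent sets *)

Section BalancedSets.
Variables (R : realType) (V : finType) (e : rel V) (d : nat).
Hypotheses (e_sym : symmetric e) (e_reg : regular e d) (d_gt0 : (0 < d)%N).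
Variables (ell lambda : R).
Hypotheses (ell_gt0 : 0 < ell) (lambda_gt0 : 0 < lambda) (lambdaE : 1 + lambda = expR ell).

Lemma sum_small_subsets (U : {set V}) (al s : R) :
  0 <= s -> ell * al + al * s + expR (- s) <= ell / 4 ->
  \sum_(A in small_subsets U (al * #|U|%:R)) lambda ^+ #|A|
    <= expR (ell * #|U|%:R / 4).
Proof.
move=> s_ge0 al_le.
apply: (@le_trans _ _ (\sum_(A in small_subsets U (al * #|U|%:R))
    expR (ell * (al * #|U|%:R)))).
  apply: ler_sum => A; rewrite inE => /andP[_ Am].
  apply: (@le_trans _ _ ((1 + lambda) ^+ #|A|)).
    by rewrite lerXn2r ?nnegrE ?addr_ge0 ?lerDr // ltW.
  by rewrite lambdaE -expRM_natr ler_expR ler_pM2l.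
rewrite sumr_const -[leLHS]mulr_natl.
apply: le_trans (ler_wpM2r (expR_ge0 _) (card_small_subsets _ _ s_ge0)) _.
rewrite -expRD ler_expR.
have := ler_wpM2r (ler0n R #|U|) al_le; lra.
Qed.

Section OneSide.
Variables (E O : {set V}) (delta al b : R).
Hypotheses (EO : bipartition e E O) (card_EO : #|O| = #|E|).
Hypotheses (b_ge0 : 0 <= b) (delta_ge0 : 0 <= delta).
Local Notation M := #|E|.
Hypothesis expanding : forall A : {set V}, A \subset E -> A != set0 -> small e E A ->
  delta * #|nbhd e A|%:R <= #|nbhd e A|%:R - #|nclosure e A|%:R.
Hypothesis class_weight : forall a g : nat,
  delta * g%:R <= g%:R - a%:R -> al * M%:R <= g%:R ->
  \sum_(A in closure_class e E a g) lambda ^+ #|A|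
    <= 2 * expR (ell * g%:R - b * (g%:R - a%:R) / 8).

Definition large_small_sets : {set {set V}} :=
  [set A : {set V} | [&& A \subset E, A != set0, small e E A & al * M%:R <= #|A|%:R]].

(** The sets are grouped by the at most [M.+1 ^ 2] pairs of sizes [(a, g)]. In each group the other
    side contributes [(1 + lambda) ^+ (M - g)], which cancels the main term of the class weight and
    leaves the gain from [g - a >= delta * g]. *)
Lemma large_small_weight :
  \sum_(A in large_small_sets) lambda ^+ #|A| * (1 + lambda) ^+ #|O :\: nbhd e A|
    <= 2 * M.+1%:R ^+ 2 * expR (ell * M%:R - b * delta * (al * M%:R) / 8).
Proof.
pose key (A : {set V}) : 'I_M.+1 * 'I_M.+1 := (inord #|nclosure e A|, inord #|nbhd e A|).
have keyP A : A \in large_small_sets -> #|nclosure e A| = (key A).1 /\ #|nbhd e A| = (key A).2.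
  rewrite inE => /and4P[AE _ _ _].
  rewrite /= !inordK // ltnS.
    by rewrite -card_EO subset_leq_card // (nbhd_sub EO).
  by rewrite subset_leq_card // (nclosure_sub EO e_reg).
rewrite (partition_big key predT) //=.
set h := expR _.
apply: (@le_trans _ _ (\sum_(p : 'I_M.+1 * 'I_M.+1) 2 * h)); last first.
  by rewrite sumr_const card_prod card_ord -[leLHS]mulr_natl natrM; lra.
apply: ler_sum => -[a g] _.
(* A pair attained by no set contributes 0; otherwise a representative supplies the inequalities on
   [a] and [g]. *)
have [[A0 [A0L A0key]]|noA] :=
  pselect (exists A0, A0 \in large_small_sets /\ key A0 = (a, g)); last first.
  rewrite big1 ?mulr_ge0 ?expR_ge0 // => A /andP[AL /eqP Akey].
  by case: noA; exists A.
have := keyP _ A0L; rewrite A0key /= => -[a0 g0].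
have := A0L; rewrite inE => /and4P[A0E A00 A0s A0al].
have dg : delta * g%:R <= g%:R - a%:R by rewrite -a0 -g0; exact: expanding.
have alg : al * M%:R <= g%:R.
  apply: le_trans A0al _; rewrite ler_nat -g0.
  apply: leq_trans (card_nclosure_le e_sym e_reg d_gt0 A0).
  exact: subset_leq_card (sub_nclosure e A0).
have gM : (g <= M)%N by rewrite -ltnS.
apply: (@le_trans _ _ ((1 + lambda) ^+ (M - g) * \sum_(A in closure_class e E a g) lambda ^+ #|A|)).
  rewrite mulr_sumr [leLHS]big_mkcond [leRHS]big_mkcond /=; apply: ler_sum => A _.
  have pos : 0 <= (1 + lambda) ^+ (M - g) * lambda ^+ #|A|.
    by rewrite mulr_ge0 ?exprn_ge0 ?addr_ge0 // ltW.
  case: ifP => [/andP[AL /eqP Akey]|_]; last by case: ifP.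
  have := keyP _ AL; rewrite Akey /= => -[aA gA].
  have := AL; rewrite inE => /and4P[AE A_0 As Aal].
  rewrite inE AE A_0 aA gA !eqxx /= mulrC.
  by rewrite cardsD (setIidPr (nbhd_sub EO AE)) gA card_EO.
apply: le_trans (ler_wpM2l _ (class_weight dg alg)) _.
  by rewrite exprn_ge0 // addr_ge0 // ltW.
rewrite lambdaE -expRM_natr mulrCA -expRD ler_pM2l // ler_expR natrB //.
have : b * (delta * (al * M%:R)) <= b * (g%:R - a%:R).
  by rewrite ler_wpM2l //; apply: le_trans dg; rewrite ler_wpM2l.
lra.
Qed.

End OneSide.

(** An independent set is determined by its traces on [E] and [O], and its weight is the product of
    theirs. *)
Lemma hc_weight_le_pairs (E O : {set V}) (X : {set indep_set e})
    (P : pred {set V}) (Q : {set V} -> pred {set V}) :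
  bipartition e E O ->
  (forall I, I \in X -> P (val I :&: E) /\ Q (val I :&: E) (val I :&: O)) ->
  hc_weight lambda X
    <= \sum_(A : {set V} | P A) \sum_(B : {set V} | Q A B) lambda ^+ #|A| * lambda ^+ #|B|.
Proof.
move=> EO XPQ; pose f (I : indep_set e) := (val I :&: E, val I :&: O).
have f_inj : injective f.
  move=> I J [IJE IJO]; apply: val_inj.
  case: EO => EOT _ _; rewrite -[val I]setIT -[val J]setIT -EOT !setIUr.
  by rewrite IJE IJO.
pose w (p : {set V} * {set V}) := lambda ^+ #|p.1| * lambda ^+ #|p.2|.
have fw (I : indep_set e) : lambda ^+ #|val I| = w (f I).
  rewrite /w /f /= -exprD -cardsUI -setIUr.
  case: EO => -> EO0 _; rewrite setIT setIACA EO0 setI0 cards0.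
  by rewrite addn0.
rewrite pair_big_dep /= /hc_weight.
rewrite (eq_bigr (fun I => w (f I)) (fun I _ => fw I)).
rewrite -(big_imset w) /=; last by move=> I J _ _; exact: f_inj.
rewrite [leLHS]big_mkcond [leRHS]big_mkcond /=; apply: ler_sum => p _.
have w_ge0 : 0 <= w p by rewrite mulr_ge0 ?exprn_ge0 // ltW.
case: ifP => [/imsetP[I IX pE]|_]; last by case: ifP.
by have [PI QI] := XPQ _ IX; rewrite pE PI QI.
Qed.

Section BothSides.
Variables (E O : {set V}) (delta al b s : R).
Hypotheses (EO : bipartition e E O) (card_EO : #|O| = #|E|).
Hypotheses (b_ge0 : 0 <= b) (delta_ge0 : 0 <= delta) (al_gt0 : 0 < al).
Local Notation M := #|E|.
Hypothesis expanding : forall A : {set V},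
  (A \subset E) || (A \subset O) -> A != set0 -> small e E A ->
  delta * #|nbhd e A|%:R <= #|nbhd e A|%:R - #|nclosure e A|%:R.
Hypothesis class_weight : forall (F : {set V}) (a g : nat), F = E \/ F = O ->
  delta * g%:R <= g%:R - a%:R -> al * M%:R <= g%:R ->
  \sum_(A in closure_class e F a g) lambda ^+ #|A|
    <= 2 * expR (ell * g%:R - b * (g%:R - a%:R) / 8).
Hypotheses (s_ge0 : 0 <= s) (al_le : ell * al + al * s + expR (- s) <= ell / 4).

Definition balanced : {set indep_set e} :=
  [set I : indep_set e | #|val I :&: E| == #|val I :&: O|].

Lemma independent_nbhd (I : indep_set e) (F G : {set V}) :
  [disjoint val I :&: G & nbhd e (val I :&: F)].
Proof.
rewrite disjoint_subset; apply/fintype.subsetP => v /setIP[vI _].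
rewrite inE; apply/negP => /nbhdP[u /setIP[uI _]]; rewrite inE.
by apply/negP; exact: (forall_inP (forall_inP (valP I) u uI)).
Qed.

(** The closure of [I] on [E] and the neighbourhood of [I] on [O] are disjoint subsets of [E]. If
    the former exceeds [M / 2], the latter is below [M / 2] and dominates the closure on [O]. *)
Lemma small_side (I : indep_set e) :
  small e E (val I :&: E) || small e E (val I :&: O).
Proof.
have [//|] := boolP (small e E (val I :&: E)); rewrite /small -ltnNge /= => A_large.
set A := val I :&: E in A_large *; set B := val I :&: O.
have := card_nclosure_le e_sym e_reg d_gt0 B => B_le.
have disj : [disjoint nclosure e A & nbhd e B].
  rewrite disjoint_subset; apply/fintype.subsetP => u; rewrite inE => /fintype.subsetP uA.
  rewrite inE; apply/negP => /nbhdP[w wB]; rewrite in_neighbours_sym // => /uA.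
  move: (independent_nbhd I E O); rewrite disjoint_subset => /fintype.subsetP/(_ w wB).
  by rewrite inE => /negbTE ->.
have : (#|nclosure e A| + #|nbhd e B| <= M)%N.
  rewrite -cardsUI (disjoint_setI0 disj) cards0 addn0 subset_leq_card // subUset.
  rewrite (nclosure_sub EO e_reg) ?subsetIr //=.
  by apply: (nbhd_sub (bipartitionC EO)); exact: subsetIr.
move: B_le A_large; clear; lia.
Qed.

Lemma balanced_weight :
  hc_weight lambda balanced <= expR (ell * M%:R / 2)
    + 4 * M.+1%:R ^+ 2 * expR (ell * M%:R - b * delta * (al * M%:R) / 8).
Proof.
have lambda_ge0 := ltW lambda_gt0.
set h := expR (_ - _).
pose X0 := [set I in balanced | #|val I :&: E|%:R <= al * M%:R].
pose X1 := [set I in balanced | (al * M%:R <= #|val I :&: E|%:R) && small e E (val I :&: E)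
   && (val I :&: E != set0)].
pose X2 := [set I in balanced | (al * M%:R <= #|val I :&: O|%:R) && small e E (val I :&: O)
   && (val I :&: O != set0)].
(* Balance makes the trace on [O] as small as that on [E], so each side contributes at most
   [expR (ell * M / 4)]. *)
have w0 : hc_weight lambda X0 <= expR (ell * M%:R / 2).
  apply: le_trans (hc_weight_le_pairs (P := mem (small_subsets E (al * M%:R)))
    (Q := fun _ => mem (small_subsets O (al * #|O|%:R))) EO _) _.
    by move=> I; rewrite !inE card_EO => /andP[/eqP <- ->]; rewrite !subsetIr.
  rewrite -big_distrlr /=.
  have -> : expR (ell * M%:R / 2) = expR (ell * M%:R / 4) * expR (ell * #|O|%:R / 4).
    by rewrite -expRD card_EO; congr expR; field.
  apply: ler_pM; try by [apply: sumr_ge0 => A _; rewrite exprn_ge0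
                        |exact: (sum_small_subsets _ s_ge0)].
have sidew (F G : {set V}) (X : {set indep_set e}) :
    bipartition e F G -> #|G| = #|F| -> #|F| = #|E| ->
    F = E \/ F = O ->
    (forall I, I \in X -> [/\ al * M%:R <= #|val I :&: F|%:R,
       small e E (val I :&: F) & val I :&: F != set0]) ->
    hc_weight lambda X <= 2 * M.+1%:R ^+ 2 * h.
  move=> FG cGF cFE F_EO XP.
  apply: le_trans (hc_weight_le_pairs (P := fun A => A \in large_small_sets F al)
    (Q := fun A B => B \subset G :\: nbhd e A) FG _) _.
    move=> I /XP[I1 I2 I3]; split.
      by rewrite in_set subsetIr I3 cFE I1 andbT /=; move: I2; rewrite /small cFE.
    by rewrite subsetD subsetIr independent_nbhd.
  under eq_bigr => A _ do rewrite -mulr_sumr sum_subsets_expr.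
  have := @large_small_weight F G delta al b FG cGF b_ge0 delta_ge0; rewrite cFE; apply.
    move=> A AF A0 As; apply: expanding => //; last by move: As; rewrite /small cFE.
    by case: F_EO AF => -> ->; rewrite ?orbT.
  by move=> a g; exact: class_weight.
have w1 : hc_weight lambda X1 <= 2 * M.+1%:R ^+ 2 * h.
  apply: (sidew E O) => //; first by left.
  by move=> I; rewrite inE => /andP[_ /andP[/andP[]]].
have w2 : hc_weight lambda X2 <= 2 * M.+1%:R ^+ 2 * h.
  apply: (sidew O E) => //; [exact: bipartitionC|by right|].
  by move=> I; rewrite inE => /andP[_ /andP[/andP[]]].
have cover : hc_weight lambda balanced <= hc_weight lambda X0 + hc_weight lambda X1
    + hc_weight lambda X2.
  rewrite /hc_weight [X in X <= _]big_mkcond [X in _ <= X + _ + _]big_mkcond.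
  rewrite [X in _ <= _ + X + _]big_mkcond [X in _ <= _ + X]big_mkcond -!big_split /=.
  apply: ler_sum => I _; have w_ge0 : 0 <= lambda ^+ #|val I| by rewrite exprn_ge0.
  have [IB|IB] := boolP (I \in balanced); last first.
    by rewrite !addr_ge0 //; case: ifP.
  have : [|| I \in X0, I \in X1 | I \in X2].
    have bal : #|val I :&: E| = #|val I :&: O| by move: IB; rewrite inE => /eqP.
    rewrite [I \in X0]inE [I \in X1]inE [I \in X2]inE IB -bal /=.
    have [//|al_lt] := lerP _ (al * M%:R); rewrite (ltW al_lt) /=.
    have A_gt0 : (0 < #|val I :&: E|)%N.
      by rewrite -(ltr0n R); apply: le_lt_trans al_lt; rewrite mulr_ge0 // ltW.
    by rewrite -!card_gt0 -bal A_gt0 !andbT small_side.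
  by do 3![case: (I \in _) => //=] => _; rewrite ?addr0 ?add0r ?lerDl ?lerDr ?addr_ge0.
lra.
Qed.

End BothSides.
End BalancedSets.

(** * Balanced sets separate the two dominated classes *)

Section Bottleneck.
Variables (R : realType) (V : finType) (e : rel V) (lambda : R) (E O : {set V}).
Hypotheses (EO : bipartition e E O) (lambda_gt0 : 0 < lambda).

Definition dominated (F G : {set V}) : {set indep_set e} :=
  [set I : indep_set e | (#|val I :&: G| < #|val I :&: F|)%N].

Lemma card_indep_sides (I : {set V}) : #|I| = (#|I :&: E| + #|I :&: O|)%N.
Proof.
case: EO => EOT EO0 _.
by rewrite -cardsUI -setIUr EOT setIT setIACA EO0 setI0 cards0 addn0.
Qed.

(** A move changes only one of the two counts, by one, so the sign of their difference cannot flip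
    without passing through zero. *)
Lemma glauber_dominated I J : I \in dominated E O -> J \notin dominated E O ->
  J \notin balanced e E O -> glauber e lambda J I = 0.
Proof.
rewrite !inE -leqNgt => IE JE JB.
have {JB} JO : (#|val J :&: E| < #|val J :&: O|)%N by rewrite ltn_neqAle JB.
rewrite /glauber; case: eqP => [JI|_]; first by move: IE; rewrite -JI ltnNge ltnW.
rewrite /glauber_move; case: eqP => // /card_symdiff1.
have sub (X Y F : {set V}) : X \subset Y -> (#|X :&: F| <= #|Y :&: F|)%N.
  by move=> XY; rewrite subset_leq_card // setSI.
rewrite (card_indep_sides (val I)) (card_indep_sides (val J)).
case=> -[XY [_]]; have := sub _ _ E XY; have := sub _ _ O XY; move: IE JO;
  move: #|val I :&: E| #|val I :&: O| #|val J :&: E| #|val J :&: O|; clear; lia.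
Qed.

(** Every nonempty subset of [E] is independent and dominated by [E]; the subtracted 1 is the empty
    set. *)
Lemma hc_weight_dominated :
  (1 + lambda) ^+ #|E| - 1 <= hc_weight lambda (dominated E O).
Proof.
have sub_indep (A : {set V}) : A \subset E -> independent e A.
  move=> /fintype.subsetP AE; apply/forall_inP => x /AE xE.
  apply/forall_inP => y /AE yE; apply/negP => xy.
  have := fintype.subsetP (neighbours_E EO xE) y; rewrite inE => /(_ xy) yO.
  case: EO => _ /setP/(_ y); rewrite in_setI yE yO.
  by rewrite in_set0.
rewrite -sum_subsets_expr (bigD1 set0) ?sub0set //= cards0 expr0 addrAC subrr add0r.
rewrite (eq_bigl (fun A => A \in [set A : {set V} | (A \subset E) && (A != set0)])); last first.
  by move=> A; rewrite in_set.
pose Y := [set I in dominated E O | val I \subset E].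
apply: (@le_trans _ _ (hc_weight lambda Y)).
  have <- : \sum_(A in [set val I | I in Y]) lambda ^+ #|A| = hc_weight lambda Y.
    by rewrite big_imset //= => I J _ _; exact: val_inj.
  rewrite [leLHS]big_mkcond [leRHS]big_mkcond /=; apply: ler_sum => A _.
  have w_ge0 : 0 <= lambda ^+ #|A| by rewrite exprn_ge0 // ltW.
  case: ifP => [|_]; last by case: ifP.
  rewrite in_set => /andP[AE A0]; rewrite ifT //.
  apply/imsetP; exists (exist _ A (sub_indep A AE) : indep_set e) => //.
  rewrite !in_set /= AE andbT; have -> : A :&: O = set0.
    by apply/eqP; rewrite -subset0; case: EO => _ <- _; rewrite setSI.
  by rewrite cards0 (setIidPl AE) card_gt0.
rewrite /hc_weight [leLHS]big_mkcond [leRHS]big_mkcond /=; apply: ler_sum => I _.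
rewrite in_set; case: (I \in _) => //=; case: ifP => // _.
by rewrite exprn_ge0 // ltW.
Qed.
End Bottleneck.

Lemma balancedC (V : finType) (e : rel V) (E O : {set V}) : balanced e E O = balanced e O E.
Proof. by apply/setP => I; rewrite !inE eq_sym. Qed.

Lemma bipartite_mixing_ge (R : realType) (V : finType) (e : rel V) (lambda : R)
    (E O : {set V}) t :
  bipartition e E O -> #|O| = #|E| -> 0 < lambda ->
  20 * t%:R * hc_weight lambda (balanced e E O) < (1 + lambda) ^+ #|E| - 1 ->
  (t <= mixing_time (glauber e lambda) (hard_core e lambda))%N.
Proof.
move=> EO cEO lambda_gt0.
(* The lighter dominated class serves as [S]: its complement contains the heavier one. *)
wlog : E O EO cEO / hc_weight lambda (dominated e E O) <= hc_weight lambda (dominated e O E).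
  move=> wl; have [|/ltW] :=
    lerP (hc_weight lambda (dominated e E O)) (hc_weight lambda (dominated e O E)).
    exact: wl.
  by rewrite balancedC -cEO; apply: wl => //; exact: bipartitionC.
move=> EO_le t_lt; apply: (glauber_bottleneck lambda_gt0
  (S := dominated e E O) (B := balanced e E O)).
- exact: glauber_dominated.
- apply: le_trans EO_le _; rewrite /hc_weight [leLHS]big_mkcond [leRHS]big_mkcond /=.
  apply: ler_sum => I _; have w_ge0 : 0 <= lambda ^+ #|val I| by rewrite exprn_ge0 // ltW.
  case: ifP => [|_]; last by case: ifP.
  by rewrite !inE => OE; rewrite ifT // -leqNgt ltnW.
- exact: lt_le_trans t_lt (hc_weight_dominated EO lambda_gt0).
Qed.

Lemma card_bipartition (V : finType) (e : rel V) (E O : {set V}) d :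
  symmetric e -> bipartition e E O -> regular e d -> (0 < d)%N ->
  #|O| = #|E| /\ #|V| = (2 * #|E|)%N.
Proof.
move=> e_sym EO e_reg d_gt0.
have cOE : #|O| = #|E|.
  apply/eqP; rewrite -(eqn_pmul2r d_gt0) -!sum_nat_const; apply/eqP.
  have edge (F G : {set V}) : bipartition e F G ->
      (\sum_(u in F) d = \sum_(u in F) #|neighbours e u :&: G|)%N.
    by move=> FG; apply: eq_bigr => u uF; rewrite (setIidPl (neighbours_E FG uF)) e_reg.
  by rewrite (edge E O EO) (edge O E (bipartitionC EO)); apply: double_count.
split=> //; case: EO => EOT EO0 _.
by rewrite -cardsT -EOT cardsU EO0 cards0 subn0 cOE addnn mul2n.
Qed.

Lemma bip_expansion_le1 (R : realType) (V : finType) (e : rel V) (E O : {set V}) :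
  bip_expansion e R E O <= 1.
Proof. exact: bigmin_le_id. Qed.

Lemma bip_expansionP (R : realType) (V : finType) (e : rel V) (E O A : {set V}) :
  0 < bip_expansion e R E O -> (A \subset E) || (A \subset O) -> A != set0 -> small e E A ->
  bip_expansion e R E O * #|nbhd e A|%:R <= #|nbhd e A|%:R - #|nclosure e A|%:R :> R.
Proof.
move=> delta_gt0 AEO A0 As.
have le_ratio : bip_expansion e R E O <= expansion_ratio e R A.
  by apply: bigmin_le_cond; rewrite A0 AEO As.
(* With an empty neighbourhood the ratio is 0 by the convention on division, against [delta > 0]. *)
have [g0|g_gt0] := posnP #|nbhd e A|.
  move: (lt_le_trans delta_gt0 le_ratio).
  by rewrite /expansion_ratio g0 invr0 mulr0 ltxx.
by rewrite -ler_pdivlMr // ltr0n.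
Qed.

(** * The functions alpha and beta *)

Section Numerics.
Variable R : realType.

Lemma ln2_bounds : (2^-1 <= ln 2 :> R) * (ln 2 <= 1 :> R) * (0 < ln 2 :> R).
Proof.
have h : 2^-1 <= ln 2 :> R.
  rewrite -ler_expR lnK ?posrE //.
  have := expR_ge1Dx (- 2^-1 : R); rewrite expRN.
  have -> : 1 - 2^-1 = 2^-1 :> R by field.
  by rewrite lef_pV2 ?posrE ?expR_gt0.
split; last by apply: lt_le_trans h; rewrite invr_gt0.
split=> //; rewrite -ler_expR lnK ?posrE //; exact: expR_ge1Dx.
Qed.

Lemma log2_ge (x y : R) : 2 `^ y <= x -> y <= log2 x.
Proof.
move=> yx; rewrite ler_pdivlMr ?ln2_bounds // -ln_powR.
by rewrite ler_ln ?posrE ?powR_gt0 //; apply: lt_le_trans yx; rewrite powR_gt0.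
Qed.

Lemma log2_2D (x : R) : 0 <= x -> 1 <= log2 (2 + x) <= 1 + x.
Proof.
move=> x_ge0; have l2 := ln2_bounds; apply/andP; split.
  by apply: log2_ge; rewrite powRr1 // lerDl.
rewrite ler_pdivrMr ?l2 //.
have -> : 2 + x = 2 * (1 + x / 2) by field.
rewrite lnM ?posrE //; last by rewrite ltr_pwDl // divr_ge0.
have x2_ge0 : 0 <= x / 2 by rewrite divr_ge0.
have : ln (1 + x / 2) <= x / 2 by apply: le_ln1Dx; lra.
have : x / 2 <= x * ln 2 by rewrite ler_wpM2l ?l2.
lra.
Qed.

(** The witness satisfies [expR (- s) = 1 / (32 * (2 + 1 / Lg))], which is at most [ell / 16]. The
    constant 44 then suffices: [1/44 + 6/44 + 1/16 <= 1/4]. *)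
Lemma alpha_small (lambda : R) : 0 < lambda ->
  exists2 s, 0 <= s &
    ln (1 + lambda) * alpha lambda + alpha lambda * s + expR (- s) <= ln (1 + lambda) / 4.
Proof.
move=> lambda_gt0; have [[l2_ge l2_le] l2_gt] := ln2_bounds.
rewrite /alpha; set Lg := log2 (1 + lambda); set ell := ln (1 + lambda).
have ell_gt0 : 0 < ell by rewrite ln_gt0 // ltrDl.
have Lg_gt0 : 0 < Lg by rewrite divr_gt0.
have ellE : ell = Lg * ln 2 by rewrite divfK // gt_eqF.
have y_gt0 : 0 < 1 / Lg by rewrite divr_gt0.
have /andP[] := log2_2D (ltW y_gt0); set q := log2 _ => q_ge1 _.
have q_gt0 : 0 < q by lra.
have qE : expR (q * ln 2) = 2 + 1 / Lg.
  by rewrite divfK ?gt_eqF // lnK // posrE addr_gt0.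
exists (5 * ln 2 + q * ln 2).
  by rewrite addr_ge0 // mulr_ge0 // ltW.
set al := Lg / _.
have alE : al * (1 + Lg) * q * 44 = Lg.
  by rewrite /al; field; rewrite !gt_eqF ?addr_gt0.
have al_gt0 : 0 < al by rewrite divr_gt0 // mulr_gt0 // mulr_gt0 // addr_gt0.
have al_q : al * q * 44 <= Lg by nra.
have al1 : al * q * 44 <= 1 by nra.
have al2 : al * 44 <= 1 by nra.
have h1 : ell * al <= ell / 44.
  by rewrite ler_pdivlMr // -mulrA ler_piMr // ltW.
have h2 : al * (5 * ln 2 + q * ln 2) <= 6 * ell / 44.
  have al_le : al <= al * q by rewrite ler_peMr // ltW.
  have h : al * 5 + al * q <= 6 * Lg / 44 by lra.
  by have := ler_wpM2r (ltW l2_gt) h; rewrite ellE; lra.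
have h3 : expR (- (5 * ln 2 + q * ln 2)) <= ell / 16.
  rewrite expRN expRD qE [5 * _]mulrC -[5]/(5%:R) expRM_natr lnK ?posrE //.
  rewrite -[leLHS]mul1r ler_pdivrMr; last by rewrite mulr_gt0 ?exprn_gt0 // addr_gt0.
  rewrite ellE.
  have -> : Lg * ln 2 / 16 * (2 ^+ 5 * (2 + 1 / Lg)) = ln 2 * 2 * (2 * Lg + 1).
    by field; rewrite gt_eqF.
  nra.
lra.
Qed.

(** Applied with [z] the fourth root of [d], this gives [alpha >= 1 / (176 * sqrt d)]. It uses
    [1 + Lg <= 2 * z * Lg] and [q <= 2 * z], and [176 = 44 * 4]. *)
Lemma alpha_ge (lambda z : R) : 0 < lambda -> 1 <= z -> 1 <= z * ln (1 + lambda) ->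
  1 <= 176 * (z * z) * alpha lambda.
Proof.
move=> lambda_gt0 z_ge1 z_ell; have [[l2_ge l2_le] l2_gt] := ln2_bounds.
rewrite /alpha; set Lg := log2 (1 + lambda).
have ell_gt0 : 0 < ln (1 + lambda) by rewrite ln_gt0 // ltrDl.
have Lg_gt0 : 0 < Lg by rewrite divr_gt0.
have z_Lg : 1 <= z * Lg.
  apply: le_trans z_ell _; rewrite ler_wpM2l //; first lra.
  by rewrite ler_pdivlMr // ler_piMr // ltW.
have y_gt0 : 0 < 1 / Lg by rewrite divr_gt0.
have y_le : 1 / Lg <= z by rewrite ler_pdivrMr.
have /andP[] := log2_2D (ltW y_gt0); set q := log2 _ => q_ge1 q_le.
have q_gt0 : 0 < q by lra.
rewrite mulrA ler_pdivlMr ?mul1r; last by rewrite mulr_gt0 // mulr_gt0 // addr_gt0.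
have q_le2 : q <= 2 * z by lra.
have h : 1 + Lg <= 2 * z * Lg by nra.
have : (1 + Lg) * q <= 2 * z * Lg * (2 * z) by apply: ler_pM => //; lra.
lra.
Qed.

End Numerics.

(** * Final estimates and choice of constants *)

Lemma ln_ge1 (R : realType) (x : R) : 4 <= x -> 1 <= ln x.
Proof.
move=> x_ge; rewrite -ler_expR lnK ?posrE; last by apply: lt_le_trans x_ge.
exact: le_trans (expR1_le4 R) x_ge.
Qed.

(** Here [w] is the fourth root of [M] and [m = M + 1]. The polynomial factor costs [8 * w], and
    [X / 8 - X / 32 - 8 * w >= 16]; the resulting [expR (- 16)] beats the constant
    [680 = 20 * 2 * 17]. *)
Lemma bottleneck_numerics (R : realType) (Y X w m B t : R) :
  1 <= w -> 256 * w <= X -> X <= Y -> 0 <= m -> m <= 2 * expR (4 * w) ->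
  B <= expR (Y / 2) + 4 * m ^+ 2 * expR (Y - X / 8) ->
  0 <= t -> t <= 2 * expR (X / 32) -> 20 * t * B < expR Y - 1.
Proof.
move=> w_ge1 X_ge XY m_ge0 m_le B_le t_ge0 t_le.
have m2 : m ^+ 2 <= 4 * expR (8 * w).
  have -> : 4 * expR (8 * w) = (2 * expR (4 * w)) ^+ 2.
    by rewrite exprMn -expRM_natr -natrX; congr (_ * expR _); ring.
  by rewrite lerXn2r ?nnegrE // mulr_ge0 ?expR_ge0.
have e8w : 1 <= expR (8 * w) by rewrite -[leLHS]expR0 ler_expR; lra.
have B17 : B <= 17 * (expR (8 * w) * expR (Y - X / 8)).
  apply: le_trans B_le _.
  have h1 : expR (Y / 2) <= expR (Y - X / 8) by rewrite ler_expR; lra.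
  have E0 := expR_ge0 (Y - X / 8).
  have h2 := ler_wpM2r E0 m2; have h3 := ler_wpM2r E0 e8w.
  lra.
have tB : 20 * t * B <= 20 * (2 * expR (X / 32)) * (17 * (expR (8 * w) * expR (Y - X / 8))).
  have [B_neg|B_pos] := lerP B 0.
    apply: (@le_trans _ _ 0); first by rewrite mulr_ge0_le0 // mulr_ge0.
    by rewrite !mulr_ge0 ?expR_ge0.
  by apply: ler_pM => //; [rewrite mulr_ge0 | exact: ltW | rewrite ler_pM2l].
apply: le_lt_trans tB _.
have -> : 20 * (2 * expR (X / 32)) * (17 * (expR (8 * w) * expR (Y - X / 8)))
    = 680 * (expR (X / 32) * expR (8 * w) * expR (Y - X / 8)) by ring.
have e16 : expR (- 16) <= (2 ^+ 12)^-1 :> R.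
  rewrite expRN lef_pV2 ?posrE ?expR_gt0 ?exprn_gt0 //.
  have -> : expR 16 = expR 1 ^+ 16 :> R by rewrite -expRM_natr mul1r.
  apply: (@le_trans _ _ (2 ^+ 16)).
    by rewrite -!natrX ler_nat.
  rewrite lerXn2r ?nnegrE ?expR_ge0 //; exact: expR_ge1Dx.
have : expR (X / 32) * expR (8 * w) * expR (Y - X / 8) <= expR Y * (2 ^+ 12)^-1.
  apply: (@le_trans _ _ (expR Y * expR (- 16))); last by rewrite ler_wpM2l ?expR_ge0.
  by rewrite -!expRD ler_expR; lra.
have : 1 + Y <= expR Y by exact: expR_ge1Dx.
have -> : (2 ^+ 12)^-1 = 4096^-1 :> R by rewrite -natrX.
lra.
Qed.

(** This is where [N >= d^2] matters. The bounds on [b * delta] and [al] give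
    [X >= 2^18 * M / (176 * D^(3/2))], and [D^(3/2) <= 4 * w^3] while [M = w^4], which leaves a
    multiple of [w]. *)
Lemma exponent_bound (R : realType) (b delta al M D sD L w : R) :
  0 < b -> 0 < delta -> 0 < al -> 1 <= L -> 1 <= w -> w ^+ 4 = M ->
  0 < sD -> sD * sD = D -> D ^+ 2 <= 2 * M -> 1 <= 176 * sD * al ->
  2 ^+ 18 * L ^+ 2 <= b * delta * D -> 256 * w <= b * delta * al * M.
Proof.
move=> b_gt0 delta_gt0 al_gt0 L_ge1 w_ge1 wM sD_gt0 sDD DM al_ge bD.
have D_gt0 : 0 < D by rewrite -sDD mulr_gt0.
have M_gt0 : 0 < M by rewrite -wM exprn_gt0; lra.
have w_gt0 : 0 < w by lra.
set X := b * delta * al * M; have X_gt0 : 0 < X by rewrite !mulr_gt0.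
have D_le : D <= 2 * w ^+ 2.
  rewrite -(ler_pXn2r (n := 2)) ?nnegrE ?mulr_ge0 ?exprn_ge0 ?(ltW D_gt0) ?(ltW w_gt0) //.
  by apply: le_trans DM _; rewrite exprMn -exprM wM; lra.
have sD_le : sD <= 2 * w.
  rewrite -(ler_pXn2r (n := 2)) ?nnegrE ?mulr_ge0 ?(ltW sD_gt0) ?(ltW w_gt0) //.
  by rewrite expr2 sDD exprMn; have : 0 <= w ^+ 2; [rewrite exprn_ge0 ?ltW | lra].
have h1 : b * delta * M <= 176 * sD * X.
  have := ler_wpM2l (ltW (mulr_gt0 (mulr_gt0 b_gt0 delta_gt0) M_gt0)) al_ge.
  by rewrite /X; lra.
have h2 : 2 ^+ 18 <= b * delta * D.
  by apply: le_trans bD; rewrite ler_peMr ?exprn_ge0 // expr_ge1 //; lra.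
have h3 : 2 ^+ 18 * M <= 176 * (sD * D) * X.
  have := ler_wpM2r (ltW M_gt0) h2; have := ler_wpM2r (ltW D_gt0) h1; lra.
have h4 : sD * D <= 4 * w ^+ 3.
  have -> : 4 * w ^+ 3 = 2 * w * (2 * w ^+ 2) by ring.
  by rewrite ler_pM // ltW.
have h5 : 2 ^+ 18 * w ^+ 4 <= 704 * w ^+ 3 * X.
  rewrite wM; apply: le_trans h3 _; have := ler_wpM2r (ltW X_gt0) h4; lra.
have w3 : 0 < w ^+ 3 by rewrite exprn_gt0.
have : 2 ^+ 18 * w <= 704 * X by rewrite -(ler_pM2l w3); lra.
lra.
Qed.

Theorem theorem1p1 (R : realType) :
  exists (c c0 : R) (d0 : nat), [/\ 0 < c, 0 < c0 &
    forall d : nat, (d0 <= d)%N ->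
    forall (V : finType) (e : rel V) (E O : {set V}),
      simple_graph e -> bipartition e E O -> regular e d ->
      (d ^ 2 <= #|V|)%N ->
    forall (delta lambda : R),
      delta = bip_expansion e R E O -> 0 < delta -> 0 < lambda ->
      c * Num.max (log2 (d%:R ^+ 5 / delta) / Num.sqrt d%:R)
                  (log2 d%:R ^+ 2 / (delta * d%:R)) <= beta d delta lambda ->
      2%:R `^ (c0 * #|V|%:R * alpha lambda * beta d delta lambda * delta)
        <= (mixing_time (glauber e lambda) (hard_core e lambda))%:R].
Proof.
exists (2 ^+ 18), 64^-1, 256%N; split; rewrite ?exprn_gt0 ?invr_gt0 //.
move=> d d_large V e E O [e_sym _] EO e_reg dV delta lambda deltaE delta_gt0 lambda_gt0.
have d_gt0 : (0 < d)%N by exact: leq_trans d_large.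
have [[l2_ge l2_le] l2_gt] := ln2_bounds R.
have [cEO cV] := card_bipartition e_sym EO e_reg d_gt0.
pose D : R := d%:R; pose M : R := #|E|%:R.
have D_ge : 256 <= D by rewrite ler_nat.
have D_gt0 : 0 < D by exact: lt_le_trans D_ge.
have delta_le1 : delta <= 1 by rewrite deltaE bip_expansion_le1.
pose ell := ln (1 + lambda); pose kappa := ln (D ^+ 5 / delta).
pose L := ln D; pose sD : R := Num.sqrt D; pose b := ell ^+ 2 / (ell + kappa).
have sD_gt0 : 0 < sD by rewrite sqrtr_gt0.
have sDD : sD * sD = D by rewrite -expr2 sqr_sqrtr // ltW.
have L_ge1 : 1 <= L by apply: ln_ge1; lra.
have D5_gt0 : 0 < D ^+ 5 / delta by rewrite divr_gt0 ?exprn_gt0.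
have kappaE : expR kappa = D ^+ 5 / delta by rewrite lnK.
have LE : expR L = D by rewrite lnK.
have kappa_ge1 : 1 <= kappa.
  apply: ln_ge1; rewrite ler_pdivlMr //.
  apply: (@le_trans _ _ D); first by have := D_ge; have := delta_le1; lra.
  by rewrite ler_eXnr //; lra.
have kappa_gt0 : 0 < kappa by lra.
have ell_gt0 : 0 < ell by rewrite ln_gt0 // ltrDl.
have lambdaE : 1 + lambda = expR ell by rewrite lnK // posrE addr_gt0.
have lk_gt0 : 0 < ell + kappa by rewrite addr_gt0.
have bE : b * (ell + kappa) = ell ^+ 2 by rewrite divfK // gt_eqF.
have b_gt0 : 0 < b by rewrite divr_gt0 ?exprn_gt0.
have b_le : b <= ell.
  by rewrite -(ler_pM2r lk_gt0) bE expr2 ler_pM2l // lerDl ltW.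
have betaE : beta d delta lambda = b / ln 2.
  rewrite /beta /log2 -/D -/ell -/kappa /b.
  by field; rewrite -?mulrDl !gt_eqF.
rewrite betaE => hyp.
have hyp_kappa : 2 ^+ 18 * kappa <= b * sD.
  have : 2 ^+ 18 * (log2 (D ^+ 5 / delta) / sD) <= b / ln 2.
    by apply: le_trans hyp; rewrite ler_pM2l ?exprn_gt0 // le_max lexx.
  rewrite ler_pdivlMr // [_ * ln 2](_ : _ = 2 ^+ 18 * kappa / sD).
    by rewrite ler_pdivrMr.
  by rewrite /log2 -/kappa; field; rewrite !gt_eqF.
(* Passing to natural logarithms leaves one factor [ln 2 <= 1], which is dropped. *)
have hyp_delta : 2 ^+ 18 * L ^+ 2 <= b * delta * D.
  have : 2 ^+ 18 * (log2 D ^+ 2 / (delta * D)) <= b / ln 2.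
    by apply: le_trans hyp; rewrite ler_pM2l ?exprn_gt0 // le_max lexx orbT.
  rewrite ler_pdivlMr // [_ * ln 2](_ : _ = 2 ^+ 18 * L ^+ 2 / (ln 2 * delta * D)).
    rewrite ler_pdivrMr ?mulr_gt0 // => h; apply: le_trans h _.
    by rewrite -[b * delta * D]mulrA ler_pM2l // -mulrA ler_piMl // mulr_ge0 // ltW.
  by rewrite /log2 -/L; field; rewrite !gt_eqF.
pose z : R := Num.sqrt sD.
have zz : z * z = sD by rewrite -expr2 sqr_sqrtr // ltW.
have sD_ge : 16 <= sD.
  rewrite -(ler_pXn2r (n := 2)) ?nnegrE ?(ltW sD_gt0) // [leRHS]expr2 sDD.
  by apply: le_trans D_ge; rewrite -natrX ler_nat.
have z_gt0 : 0 < z by rewrite sqrtr_gt0.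
have z_ge1 : 1 <= z.
  rewrite -(ler_pXn2r (n := 2)) ?nnegrE ?(ltW z_gt0) // [leRHS]expr2 zz expr1n; lra.
(* In fact [(z * ell)^2 = sD * b * (ell + kappa) >= kappa^2], so the hypothesis on [beta] forces
   [ell] to be at least [d^(-1/4)]. *)
have z_ell : 1 <= z * ell.
  apply: le_trans kappa_ge1 _.
  rewrite -(ler_pXn2r (n := 2)) ?nnegrE ?mulr_ge0 ?ltW //.
  rewrite exprMn expr2 [z ^+ 2]expr2 zz mulrC -bE.
  have h := ler_wpM2r (ltW lk_gt0) hyp_kappa.
  have : 0 < kappa * kappa by rewrite mulr_gt0.
  have : 0 < kappa * ell by rewrite mulr_gt0.
  lra.
pose al := alpha lambda.
have al_ge : 1 <= 176 * sD * al by rewrite -zz alpha_ge.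
have al_gt0 : 0 < al.
  have : 0 < 176 * sD * al by lra.
  by rewrite pmulr_rgt0 // mulr_gt0.
have [s s_ge0 al_le] := alpha_small lambda_gt0; rewrite -/al -/ell in al_le.
have al_le1 : al <= 1.
  have h1 : 0 <= al * s by rewrite mulr_ge0 // ltW.
  have h2 := expR_ge0 (- s).
  by rewrite -(ler_pM2l ell_gt0); lra.
have DM : D ^+ 2 <= 2 * M by rewrite -natrX -natrM ler_nat -cV.
have E_gt0 : (0 < #|E|)%N.
  rewrite -(ltr0n R) -/M; have : 0 < D ^+ 2 by rewrite exprn_gt0.
  lra.
pose w : R := Num.sqrt (Num.sqrt M).
have M_ge1 : 1 <= M by rewrite ler1n.
have w4 : w ^+ 4 = M by rewrite (exprM w 2 2) !sqr_sqrtr ?sqrtr_ge0 //; lra.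
have w_ge1 : 1 <= w.
  by rewrite -(ler_pXn2r (n := 4)) ?nnegrE ?sqrtr_ge0 // w4 expr1n.
pose X := b * delta * al * M.
have X_ge : 256 * w <= X.
  exact: exponent_bound b_gt0 delta_gt0 al_gt0 L_ge1 w_ge1 w4 sD_gt0 sDD DM al_ge hyp_delta.
have class_weight (F : {set V}) (a g : nat) : F = E \/ F = O ->
    delta * g%:R <= g%:R - a%:R -> al * #|E|%:R <= g%:R ->
    \sum_(A in closure_class e F a g) lambda ^+ #|A|
      <= 2 * expR (ell * g%:R - b * (g%:R - a%:R) / 8).
  move=> FEO dg alg.
  have M_le : M <= 176 * sD * g%:R.
    apply: (@le_trans _ _ (176 * sD * (al * M))).
      by rewrite mulrA ler_peMl //; lra.
    by rewrite ler_pM2l // mulr_gt0.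
  (* Since [D^2 <= 2 * M <= 352 * sD * g], one factor [sD] is cancelled, and [sD >= 1] absorbs
     another. *)
  have D_le : D <= 352 * g%:R.
    have h : sD * (D * sD) <= sD * (352 * g%:R).
      by have -> : sD * (D * sD) = D ^+ 2; [rewrite expr2 -{2}sDD; ring | lra].
    rewrite ler_pM2l // in h; apply: le_trans h.
    by rewrite ler_peMr // ?ltW //; lra.
  have b14 (x y : R) : 0 <= x -> 2 ^+ 18 * x <= y -> 2 ^+ 14 * x <= y.
    by move=> x_ge0; apply: le_trans; rewrite ler_wpM2r // ler_eXn2l // ltr1n.
  have side (G H : {set V}) : bipartition e G H -> #|H| = #|G| -> #|G| = #|E| ->
      \sum_(A in closure_class e G a g) lambda ^+ #|A|
        <= 2 * expR (ell * g%:R - b * (g%:R - a%:R) / 8).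
    move=> GH cHG cGE.
    apply: (closure_class_weight e_sym GH e_reg d_large cHG ell_gt0 kappa_gt0
      delta_gt0 delta_le1 lambdaE kappaE LE sD_gt0 sDD bE) => //.
    - by apply: b14; rewrite // ltW.
    - by apply: b14; rewrite ?exprn_ge0 //; lra.
    - by rewrite cGE.
  case: FEO => ->; [exact: (side E O)|apply: (side O E) => //; exact: bipartitionC].
have expanding (A : {set V}) : (A \subset E) || (A \subset O) -> A != set0 -> small e E A ->
    delta * #|nbhd e A|%:R <= #|nbhd e A|%:R - #|nclosure e A|%:R.
  by move=> AEO A0 As; rewrite deltaE; apply: bip_expansionP; rewrite -?deltaE.
have B_le := balanced_weight e_sym e_reg d_gt0 ell_gt0 lambda_gt0 lambdaE EO cEO
  (ltW b_gt0) (ltW delta_gt0) al_gt0 expanding class_weight s_ge0 al_le.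
(* The two factors [ln 2] cancel, and [#|V| = 2 * M] turns [1/64] into [1/32]. *)
have -> : 2 `^ (64^-1 * #|V|%:R * alpha lambda * (b / ln 2) * delta) = expR (X / 32).
  have {1}-> : 2 = expR (ln 2) :> R by rewrite lnK ?posrE.
  rewrite -expRM cV natrM -/al -/M; congr expR.
  by rewrite /X; field; rewrite gt_eqF.
(* Rounding up gives an integer time above the target and at most twice it, because
   [expR (X / 32) >= 1]. *)
pose t := (Num.truncn (expR (X / 32))).+1.
have /andP[t_le t_gt] : (Num.truncn (expR (X / 32)))%:R <= expR (X / 32) < t%:R.
  by apply: truncn_itv; exact: expR_ge0.
apply: (@le_trans _ _ t%:R); first exact: ltW.
rewrite ler_nat; apply: (bipartite_mixing_ge EO cEO lambda_gt0).
rewrite lambdaE -expRM_natr -/M.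
apply: (bottleneck_numerics (X := X) (w := w) (m := #|E|.+1%:R)) => //.
- rewrite /X ler_pM2r; last lra.
  apply: le_trans b_le; rewrite -mulrA ler_piMr ?(ltW b_gt0) //.
  by rewrite mulr_ile1 // ltW.
- have w_exp : w <= expR w by apply: le_trans (expR_ge1Dx w); rewrite lerDr.
  have : w ^+ 4 <= expR w ^+ 4 by rewrite lerXn2r ?nnegrE ?expR_ge0 ?sqrtr_ge0.
  rewrite -expRM_natl w4 -natr1 -/M; lra.
- by move: B_le; rewrite /X !mulrA.
- have e_ge1 : 1 <= expR (X / 32) by rewrite -[leLHS]expR0 ler_expR; lra.
  by rewrite /t -[leLHS]natr1; lra.
Qed.
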